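(* Let $\{f(\cdot;s)\}_{s\in[0,\infty)}$ be a one-parameter family of functions satisfying assumptions (A1)-(A5) listed in the context (with $f'(0;s)=1$ for all $s$). For $s\ge 0$ let $c^*(s)$ be the minimal traveling wave speed of $w_t=w_{xx}+f(w;s)$, and let $W_s$ be the minimal traveling wave (the traveling wave with speed $c^*(s)$, unique up to translation). Then there exists a threshold value $s^*\in[s_1,s_2)$ such that $$c^*(s)=2\ \text{ for all } s\in[0,s^*],\qquad c^*(s)>2\ \text{ for all } s\in(s^*,\infty).$$ Moreover, for $s\in[0,\infty)$, the minimal traveling wave $W_s$ satisfies $$W_s(\xi)=Be^{-\xi}+o(e^{-\xi})\quad\text{as }\xi\to+\infty\quad\text{for some } B>0$$ if and only if $s=s^*$.
   Context: Primes on $f$ denote derivatives with respect to $w$; $f^{(n)}$ is the $n$-th derivative of $f$ in $w$ ($f^{(0)}=f$). The assumptions are: (A1) For every $s\in[0,\infty)$: $f(\cdot;s)\in C^2([0,1])$, $f(0;s)=f(1;s)=0$, $f'(0;s)=\gamma_0>0>f'(1;s)$ with $\gamma_0$ independent of $s$, and $f(w;s)>0$ for all $w\in(0,1)$. The normalization $\gamma_0=1$ is in force. (A2) There exists $L_0>0$ such that $|f^{(n)}(w;s)-f^{(n)}(w;\hat s)|\le L_0|s-\hat s|$ for all $w\in[0,1]$, all $s,\hat s\in[0,\infty)$ and $n=0,1,2$. (A3) If $\hat s>s$, then $f(w;\hat s)>f(w;s)$ for all $w\in(0,1)$, and $f''(0;\hat s)>f''(0;s)$. (A4) There exists $s_1>0$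 such that $f(\cdot;s_1)$ satisfies the KPP condition $f'(0;s_1)w\ge f(w;s_1)$ for all $w\in[0,1]$ (and thus $c^*(s_1)=2$). (A5) There exists $s_2>s_1$ such that $c^*(s_2)>2$. Traveling waves and minimal speed: under (A1), for each $s\ge0$ there is a number $c^*(s)\ge 2$ (the minimal traveling wave speed) such that the problem $$W''+cW'+f(W;s)=0\ \text{ on }\mathbb{R},\quad W(-\infty)=1,\ W(+\infty)=0,\quad W'<0\ \text{ on }\mathbb{R}$$ has a solution $W$ if and only if $c\ge c^*(s)$, and for each such $c$ the solution is unique up to translation. The solution for $c=c^*(s)$ is the minimal traveling wave, denoted $W_s$. *)

(* Defs.v *)
From Stdlib Require Import Reals.
From Coquelicot Require Import Coquelicot.
Open Scope R_scope.

Definition unit_interval (w : R) : Prop := 0 <= w <= 1.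

(** [g] is C^2 on [0,1] with first and second derivatives [g1] and [g2].  [D_in]
    and [continue_in] are relative to [0,1], so they are one-sided at the
    endpoints, and the values of [g], [g1], [g2] off [0,1] play no role. *)
Definition C2_unit (g g1 g2 : R -> R) : Prop :=
  forall w, unit_interval w ->
    D_in g g1 unit_interval w /\
    D_in g1 g2 unit_interval w /\
    continue_in g2 unit_interval w.

(** Throughout, [f s w] stands for f(w;s), and [f1 s], [f2 s] are the first and
    second derivatives of [f s] on [0,1]; only s >= 0 matters. *)

Definition monostable_family (f f1 f2 : R -> R -> R) : Prop :=
  forall s, 0 <= s ->
    C2_unit (f s) (f1 s) (f2 s) /\
    f s 0 = 0 /\ f s 1 = 0 /\
    f1 s 0 = 1 /\ f1 s 1 < 0 /\
    (forall w, 0 < w < 1 -> 0 < f s w).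

Definition lipschitz_in_parameter (f f1 f2 : R -> R -> R) : Prop :=
  exists L0, 0 < L0 /\
    forall w s s', unit_interval w -> 0 <= s -> 0 <= s' ->
      Rabs (f s w - f s' w) <= L0 * Rabs (s - s') /\
      Rabs (f1 s w - f1 s' w) <= L0 * Rabs (s - s') /\
      Rabs (f2 s w - f2 s' w) <= L0 * Rabs (s - s').

Definition increasing_in_parameter (f f2 : R -> R -> R) : Prop :=
  forall s s', 0 <= s -> s < s' ->
    (forall w, 0 < w < 1 -> f s w < f s' w) /\ f2 s 0 < f2 s' 0.

Definition KPP_condition (g g1 : R -> R) : Prop :=
  forall w, unit_interval w -> g w <= g1 0 * w.

(** The limits and the strict monotonicity force 0 < W < 1, so [g] is only
    evaluated inside (0,1).  [ex_derive W x] is listed because [ex_derive_n W 2 x]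
    does not imply it. *)
Definition travelling_wave (g : R -> R) (c : R) (W : R -> R) : Prop :=
  (forall x, ex_derive W x /\ ex_derive_n W 2 x) /\
  (forall x, Derive_n W 2 x + c * Derive W x + g (W x) = 0) /\
  is_lim W m_infty 1 /\
  is_lim W p_infty 0 /\
  (forall x, Derive W x < 0).

(** This property determines [cmin] uniquely. *)
Definition minimal_speed (g : R -> R) (cmin : R) : Prop :=
  forall c, (exists W, travelling_wave g c W) <-> cmin <= c.

(** W(x) = B e^{-x} + o(e^{-x}) as x -> +oo for some B > 0;
    [is_domin F u v] reads v = o(u) along the filter F. *)
Definition pure_exponential_decay (W : R -> R) : Prop :=
  exists B, 0 < B /\
    is_domin (Rbar_locally p_infty)
      (fun x => exp (- x)) (fun x => W x - B * exp (- x)).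

(* Main.v *)
Require Import Defs.
From Stdlib Require Import Reals Lra ClassicalEpsilon.
From Coquelicot Require Import Coquelicot.
Open Scope R_scope.

(** A wave [W] of speed [c] is encoded by its phase-plane profile [P] on (0,1),
    [P (W x) = - W' x], which solves [P' = c - g / P] and vanishes at both ends.
    The trajectory with [P(1-) = 0] always exists, so a wave exists as soon as
    that trajectory lies below some supersolution vanishing at [w = 0]: the line
    [w] under the KPP condition, or the profile of a larger nonlinearity.  Hence
    the parameters with [c* = 2] form an interval; it contains its supremum
    [sstar], because [P_r + eta] is a supersolution for [f_s], away from [w = 0],
    when [s - r] is small.

    For [c = 2] the slope [q = P / w] satisfies
    [w q' = - ((q - 1)^2 + g / w - 1) / q], so near [w = 0] either
    [q - 1 = O(w)], which is pure exponential decay, or [q - 1] is at most of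
    order [- 1 / |ln w|], which is not.  In the first case
    [q = 1 - (g''(0) / 2) w + o(w)], which is incompatible with the existence of
    a profile for any larger parameter; so decay is not pure below [sstar].  In
    the second case the explicit supersolution [w + w / (2 ln w)] near 0, glued to
    [P + eta], gives a wave of speed 2 for slightly larger parameters; so decay is
    pure at [sstar].  For [c > 2] the slope stays away from 1. *)

(** * Comparison principles *)

(** The profile equation is singular at [w = 1], where [g] and [P] both vanish. The trajectory is
    therefore built for the energy [V = P^2 / 2] in the variable [t = 1 - w]: the equation
    [V' = g - c sqrt(2 V)] has no division, and although the root is not Lipschitz at 0, its sign
    makes the equation dissipative, which gives convergence of approximate solutions. At [w = 0]
    most slope estimates rest on one contradiction: a bounded function cannot satisfy [w q' <= - e]
    with [e > 0] all the way down to 0. Decay is read off the phase [X w + ln w], with [X] the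
    inverse of the wave: it is the logarithm of [W / e^(-x)]. Its derivative [(1 - 1/q) / w] is
    bounded when [q - 1 = O(w)], and its integral diverges like [ln |ln w|] on the slow branch. The
    coefficient 1/2 of the logarithmic barrier: a slope [1 - a / |ln w|] is a strict supersolution
    near 0 for [0 < a < 1], and the slow branch lies asymptotically below the slope with [a = 2/3].
    The value 1/2 is below both bounds. *)

Lemma nondecreasing_of_derive (F dF : R -> R) (a b : R) :
  a <= b ->
  (forall x, a <= x <= b -> is_derive F x (dF x)) ->
  (forall x, a <= x <= b -> 0 <= dF x) -> F a <= F b.
Proof.
  intros Hab HF Hd.
  destruct (MVT_gen F a b dF) as [z [Hz E]].
  - intros x Hx. rewrite Rmin_left, Rmax_right in Hx by lra. apply HF; lra.
  - intros x Hx. rewrite Rmin_left, Rmax_right in Hx by lra.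
    apply continuity_pt_filterlim, (ex_derive_continuous F).
    eexists; apply HF; lra.
  - rewrite Rmin_left, Rmax_right in Hz by lra.
    specialize (Hd z Hz). nra.
Qed.

Lemma is_derive_reflect (F : R -> R) (x l : R) :
  is_derive F (- x) l -> is_derive (fun y => F (- y)) x (- l).
Proof.
  intros H. evar_last.
  - apply (is_derive_comp F Ropp x l (-1)).
    + exact H.
    + auto_derive; [trivial | ring].
  - unfold scal; simpl; unfold mult; simpl; ring.
Qed.

Lemma nonincreasing_of_derive (F dF : R -> R) (a b : R) :
  a <= b ->
  (forall x, a <= x <= b -> is_derive F x (dF x)) ->
  (forall x, a <= x <= b -> dF x <= 0) -> F b <= F a.
Proof.
  intros Hab HF Hd.
  assert (H : - F a <= - F b).
  { apply (nondecreasing_of_derive (fun x => - F x) (fun x => - dF x)); trivial.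
    - intros x Hx. apply (is_derive_opp F). apply HF; trivial.
    - intros x Hx. specialize (Hd x Hx). lra. }
  lra.
Qed.

(** The zero is the supremum of the points up to which [F] stays positive; by continuity [F] can be
    neither negative nor positive there. The last clause makes it the first zero, as the barrier
    arguments require. *)
Lemma first_zero (F : R -> R) (a b : R) :
  a <= b -> (forall x, a <= x <= b -> continuous F x) -> 0 < F a -> F b <= 0 ->
  exists z, a < z <= b /\ F z = 0 /\ (forall x, a <= x < z -> 0 < F x).
Proof.
  intros Hab HF Ha Hb.
  pose (E := fun t => a <= t <= b /\ forall x, a <= x <= t -> 0 < F x).
  destruct (completeness E) as [z [Hz1 Hz2]].
  { exists b. intros t [Ht _]. lra. }
  { exists a. split; [lra | intros x Hx]. replace x with a by lra. trivial. }
  assert (Haz : a <= z).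
  { apply Hz1. split; [lra | intros x Hx]. replace x with a by lra. trivial. }
  assert (Hzb : z <= b) by (apply Hz2; intros t [Ht _]; lra).
  assert (Hpos : forall x, a <= x < z -> 0 < F x).
  { intros x Hx. apply Rnot_le_lt; intros Hn.
    assert (z <= x); [| lra].
    apply Hz2. intros t [Ht Ht']. apply Rnot_lt_le; intros Hl.
    specialize (Ht' x). lra. }
  assert (Hnear : forall e, 0 < e -> exists d, 0 < d /\
            forall y, Rabs (y - z) < d -> Rabs (F y - F z) < e).
  { intros e He.
    assert (C : continuity_pt F z) by (apply continuity_pt_filterlim, HF; lra).
    destruct (C e He) as [d [Hd1 Hd2]]. exists d; split; [lra|].
    intros y Hy. destruct (Req_dec y z) as [ -> | Hne].
    - rewrite Rminus_diag, Rabs_R0. lra.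
    - apply Hd2. split; [split; [exact I | auto] | exact Hy]. }
  destruct (Rtotal_order (F z) 0) as [Hneg | [Hzero | Hp]].
  - exfalso. destruct (Hnear (- F z)) as [d [Hd1 Hd2]]; [lra|].
    assert (a < z) by (destruct Haz as [ | <- ]; lra).
    pose (y := Rmax a (z - d / 2)).
    assert (Hy : a <= y < z /\ z - d / 2 <= y).
    { unfold y. split; [split|]; [apply Rmax_l | apply Rmax_lub_lt; lra | apply Rmax_r]. }
    specialize (Hpos y (proj1 Hy)).
    specialize (Hd2 y). rewrite Rabs_left in Hd2 by lra.
    assert (Hq : Rabs (F y - F z) < - F z) by (apply Hd2; lra).
    apply Rabs_def2 in Hq. lra.
  - exists z. repeat split; trivial. destruct Haz as [ | <- ]; lra.
  - exfalso. destruct (Hnear (F z)) as [d [Hd1 Hd2]]; [lra|].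
    assert (z < b) by (destruct Hzb as [ | -> ]; lra).
    pose (y := Rmin b (z + d / 2)).
    assert (Hy : z < y <= b /\ y <= z + d / 2).
    { unfold y. split; [split|]; [apply Rmin_glb_lt; lra | apply Rmin_l | apply Rmin_r]. }
    assert (y <= z); [| lra].
    apply Hz1. split; [lra|]. intros x Hx.
    destruct (Rlt_le_dec x z) as [Hxz|Hxz]; [apply Hpos; lra|].
    assert (Hq : Rabs (F x - F z) < F z).
    { apply Hd2. rewrite Rabs_right by lra. lra. }
    apply Rabs_def2 in Hq. lra.
Qed.

(** The sign of [d] is known only where [D > 0]. If [D] ended below [D a], it would first have to
    descend to some positive level below [D a], staying positive and hence nondecreasing on the
    way. *)
Lemma positive_part_nondecreasing (D d : R -> R) (a b : R) :
  a <= b ->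
  (forall x, a <= x <= b -> is_derive D x (d x)) ->
  (forall x, a <= x <= b -> 0 < D x -> 0 <= d x) ->
  0 < D a -> D a <= D b.
Proof.
  intros Hab HD Hd Ha. apply Rnot_lt_le; intros Hb.
  (* A level that is positive, strictly below [D a] and at least [D b]. *)
  pose (y := Rmax (D b) (D a / 2)).
  assert (Hy : D b <= y /\ D a / 2 <= y < D a).
  { unfold y. split; [apply Rmax_l|]. split; [apply Rmax_r | apply Rmax_lub_lt; lra]. }
  destruct (first_zero (fun x => D x - y) a b) as [z [Hz [Ez Hp]]]; try lra.
  - intros x Hx. apply (ex_derive_continuous (fun x => D x - y)).
    exists (d x - 0). apply (is_derive_minus D (fun _ => y)); [apply HD; trivial | exact (is_derive_const y x)].
  - assert (D a <= D z); [| lra].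
    apply (nondecreasing_of_derive D d); [lra | intros; apply HD; lra |].
    intros x Hx. apply Hd; [lra|].
    destruct (Rlt_le_dec x z) as [Hxz|Hxz].
    + specialize (Hp x). lra.
    + replace x with z by lra. lra.
Qed.

Lemma positive_part_nonincreasing (D d : R -> R) (a b : R) :
  a <= b ->
  (forall x, a <= x <= b -> is_derive D x (d x)) ->
  (forall x, a <= x <= b -> 0 < D x -> d x <= 0) ->
  0 < D b -> D b <= D a.
Proof.
  intros Hab HD Hd Hb.
  assert (H : D (- (- b)) <= D (- (- a))).
  { apply (positive_part_nondecreasing (fun x => D (- x)) (fun x => - d (- x))).
    - lra.
    - intros x Hx. apply is_derive_reflect, HD. lra.
    - intros x Hx Hp. assert (Hdx : d (- x) <= 0) by (apply Hd; [lra | trivial]). lra.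
    - rewrite Ropp_involutive. trivial. }
  rewrite !Ropp_involutive in H. trivial.
Qed.

Lemma ln_unbounded_below (m : R) : exists w, 0 < w < 1 /\ forall v, 0 < v <= w -> ln v < m.
Proof.
  exists (exp (- Rabs m - 1)). split.
  - split; [apply exp_pos|]. apply Rlt_le_trans with (exp 0); [| rewrite exp_0; lra].
    apply exp_increasing. assert (H := Rabs_pos m). lra.
  - intros v Hv. apply Rle_lt_trans with (ln (exp (- Rabs m - 1))).
    + destruct (proj2 Hv) as [H| ->]; [left; apply ln_increasing; lra | lra].
    + rewrite ln_exp. assert (H := Rle_abs (- m)). rewrite Rabs_Ropp in H. lra.
Qed.

(** Integration towards 0 gives [Y w >= const - e ln w], which is unbounded. The slope equation
    carries a factor [1 / w], so this excludes any uniform sign of [w q'] for a bounded slope. *)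
Lemma no_logarithmic_growth (Y y : R -> R) (w1 e M : R) :
  0 < w1 -> 0 < e ->
  (forall w, 0 < w <= w1 -> is_derive Y w (y w) /\ y w <= - e / w) ->
  ~ (forall w, 0 < w <= w1 -> Y w <= M).
Proof.
  intros Hw1 He HY HM.
  destruct (ln_unbounded_below ((Y w1 + e * ln w1 - M) / e)) as [w [Hw Hln]].
  pose (v := Rmin w w1).
  assert (Hv : 0 < v /\ v <= w /\ v <= w1).
  { unfold v. repeat split; [apply Rmin_glb_lt; lra | apply Rmin_l | apply Rmin_r]. }
  assert (H : Y w1 + e * ln w1 <= Y v + e * ln v).
  { apply (nonincreasing_of_derive (fun w => Y w + e * ln w) (fun w => y w + e * / w)).
    - lra.
    - intros x Hx. apply (is_derive_plus Y (fun w => e * ln w)); [apply HY; lra|].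
      apply is_derive_scal, is_derive_ln. lra.
    - intros x Hx. destruct (HY x) as [_ H]; [lra|]. unfold Rdiv in H. lra. }
  specialize (HM v). specialize (Hln v).
  assert (Hl : ln v < (Y w1 + e * ln w1 - M) / e) by (apply Hln; lra).
  apply (Rmult_lt_compat_l e) in Hl; [|lra].
  replace (e * ((Y w1 + e * ln w1 - M) / e)) with (Y w1 + e * ln w1 - M) in Hl by (field; lra).
  lra.
Qed.

(** [profile g c P] is the phase-plane form of the wave equation: along a wave,
    [P (W x) = - W' x].  Since [P > 0], the second clause says [P(1-) = 0]. *)
Definition profile (g : R -> R) (c : R) (P : R -> R) : Prop :=
  (forall w, 0 < w < 1 -> 0 < P w /\ is_derive P w (c - g w / P w)) /\
  (forall e, 0 < e -> exists d, 0 < d < 1 /\ forall w, 1 - d < w < 1 -> P w < e).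

Definition vanishing_at_0 (P : R -> R) : Prop :=
  forall e, 0 < e -> exists d, 0 < d < 1 /\ forall w, 0 < w < d -> P w < e.

(** The heteroclinic orbit of the phase plane, from the state 1 to the state 0: the counterpart of a
    travelling wave of speed [c]. *)
Definition connecting (g : R -> R) (c : R) (P : R -> R) : Prop :=
  profile g c P /\ vanishing_at_0 P.

Definition supersolution (g : R -> R) (c : R) (a b : R) (Z : R -> R) : Prop :=
  forall w, a <= w <= b -> 0 < Z w /\ exists z, is_derive Z w z /\ z <= c - g w / Z w.

(* Where P > Z, (P - Z)' >= g (1/Z - 1/P) >= 0: an excess persists to the right. *)
Lemma excess_over_supersolution (g P Z : R -> R) (c a b : R) :
  (forall w, 0 < w < 1 -> 0 <= g w) -> profile g c P ->
  0 < a -> a <= b -> b < 1 -> supersolution g c a b Z ->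
  Z a < P a -> P a - Z a <= P b - Z b.
Proof.
  intros Hg [HP _] Ha Hab Hb HZ H.
  apply (positive_part_nondecreasing (fun w => P w - Z w)
           (fun w => (c - g w / P w) - Derive Z w)); try lra.
  - intros w Hw. apply (is_derive_minus P Z); [apply HP; lra|].
    destruct (HZ w Hw) as [_ [z [Hz _]]]. apply Derive_correct. exists z; trivial.
  - intros w Hw Hp. destruct (HZ w Hw) as [Z0 [z [Hz1 Hz2]]].
    destruct (HP w) as [P0 _]; [lra|].
    rewrite (is_derive_unique _ _ _ Hz1).
    assert (g w / P w <= g w / Z w); [| lra].
    apply Rmult_le_compat_l; [apply Hg; lra | apply Rinv_le_contravar; lra].
Qed.

(** An excess of [P] over [Z] at [a] would persist up to [w = 1], where [P] tends to 0 while [Z] is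
    positive. *)
Lemma profile_le_supersolution (g P Z : R -> R) (c a : R) :
  (forall w, 0 < w < 1 -> 0 <= g w) -> profile g c P -> 0 < a < 1 ->
  (forall b, b < 1 -> supersolution g c a b Z) -> P a <= Z a.
Proof.
  intros Hg HP Ha HZ. apply Rnot_lt_le; intros H.
  destruct (proj2 HP (P a - Z a)) as [d [Hd Hb]]; [lra|].
  pose (b := Rmax a (1 - d / 2)).
  assert (B : a <= b < 1 /\ 1 - d / 2 <= b).
  { unfold b. split; [split|]; [apply Rmax_l | apply Rmax_lub_lt; lra | apply Rmax_r]. }
  assert (E := excess_over_supersolution g P Z c a b Hg HP (proj1 Ha)
                 (proj1 (proj1 B)) (proj2 (proj1 B)) (HZ b (proj2 (proj1 B))) H).
  destruct (HZ b (proj2 (proj1 B)) b) as [Z0 _]; [lra|].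
  specialize (Hb b). lra.
Qed.

(** * Trajectories emanating from w = 1 *)

Lemma Rmax_0_abs (x : R) : Rmax x 0 = (x + Rabs x) / 2.
Proof.
  unfold Rmax, Rabs. destruct (Rle_dec x 0); destruct (Rcase_abs x); lra.
Qed.

Lemma continuous_Rmax_0 (F : R -> R) (x : R) :
  continuous F x -> continuous (fun y => Rmax (F y) 0) x.
Proof.
  intros HF. apply (continuous_ext (fun y => / 2 * (F y + Rabs (F y)))).
  - intros y. change (/ 2 * (F y + Rabs (F y)) = Rmax (F y) 0). rewrite Rmax_0_abs. field.
  - apply (continuous_scal_r (/ 2) (fun y => F y + Rabs (F y))).
    apply (continuous_plus F (fun y => Rabs (F y))); trivial.
    apply continuous_Rabs_comp; trivial.
Qed.

Lemma sqrt_plus_le (x y : R) : 0 <= x -> 0 <= y -> sqrt (x + y) <= sqrt x + sqrt y.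
Proof.
  intros Hx Hy. assert (A := sqrt_pos x). assert (B := sqrt_pos y).
  rewrite <- (sqrt_Rsqr (sqrt x + sqrt y)) by lra.
  apply sqrt_le_1_alt. unfold Rsqr.
  assert (C := sqrt_sqrt x Hx). assert (D := sqrt_sqrt y Hy). nra.
Qed.

(** The term [c P] written in the energy [v = P^2 / 2], extended by 0 to negative energies so that
    it is total, continuous and, for [c >= 0], monotone. *)
Definition friction (c v : R) : R := c * sqrt (2 * Rmax v 0).

Lemma friction_pos (c v : R) : 0 <= c -> 0 <= friction c v.
Proof. intros Hc. apply Rmult_le_pos; [trivial | apply sqrt_pos]. Qed.

Lemma friction_le (c a b : R) : 0 <= c -> a <= b -> friction c a <= friction c b.
Proof.
  intros Hc Hab. apply Rmult_le_compat_l; trivial. apply sqrt_le_1_alt.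
  apply Rmult_le_compat_l; [lra|]. apply Rle_max_compat_r; trivial.
Qed.

Lemma friction_plus (c a b d : R) :
  0 <= c -> 0 <= d -> a <= b + d -> friction c a <= friction c b + c * sqrt (2 * d).
Proof.
  intros Hc Hd H. apply Rle_trans with (c * sqrt (2 * Rmax b 0 + 2 * d)).
  - apply Rmult_le_compat_l; trivial. apply sqrt_le_1_alt.
    assert (A := Rmax_l b 0). assert (B := Rmax_r b 0).
    assert (Rmax a 0 <= Rmax b 0 + d); [| lra].
    apply Rmax_lub; lra.
  - unfold friction.
    replace (c * sqrt (2 * Rmax b 0) + c * sqrt (2 * d))
      with (c * (sqrt (2 * Rmax b 0) + sqrt (2 * d))) by ring.
    apply Rmult_le_compat_l; trivial.
    apply sqrt_plus_le; [| lra]. assert (B := Rmax_r b 0). lra.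
Qed.

Lemma friction_dist (c a b d : R) :
  0 <= c -> 0 <= d -> Rabs (a - b) <= d ->
  Rabs (friction c a - friction c b) <= c * sqrt (2 * d).
Proof.
  intros Hc Hd H. apply Rabs_le_between in H. apply Rabs_le_between. split.
  - assert (A := friction_plus c b a d Hc Hd). lra.
  - assert (A := friction_plus c a b d Hc Hd). lra.
Qed.

Lemma continuous_friction (c : R) (F : R -> R) (x : R) :
  continuous F x -> continuous (fun y => friction c (F y)) x.
Proof.
  intros HF. apply (continuous_scal_r c (fun y => sqrt (2 * Rmax (F y) 0))).
  apply continuous_sqrt_comp. apply (continuous_scal_r 2 (fun y => Rmax (F y) 0)).
  apply continuous_Rmax_0; trivial.
Qed.

Lemma sqrt_small (c e : R) : 0 <= c -> 0 < e -> exists d, 0 < d /\ c * sqrt (2 * d) <= e.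
Proof.
  intros Hc He. exists ((e / (c + 1)) ^ 2 / 2).
  assert (H : 0 < e / (c + 1)) by (apply Rdiv_lt_0_compat; lra).
  split; [nra|].
  replace (2 * ((e / (c + 1)) ^ 2 / 2)) with ((e / (c + 1)) ^ 2) by lra.
  rewrite sqrt_pow2 by lra.
  apply Rle_trans with ((c + 1) * (e / (c + 1))); [nra | right; field; lra].
Qed.

Lemma is_derive_RInt_0 (F : R -> R) (x : R) :
  (forall y, continuous F y) -> is_derive (fun t => RInt F 0 t) x (F x).
Proof.
  intros HF. apply (is_derive_RInt F (fun t => RInt F 0 t) 0 x).
  - apply filter_forall. intros t. apply (@RInt_correct R_CompleteNormedModule).
    apply (@ex_RInt_continuous R_CompleteNormedModule). intros; apply HF.
  - apply HF.
Qed.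

(* Tonelli's retarded approximation: with delay h, the k-th iterate is already
   stationary on [0, k h]. *)
Definition retarded (G : R -> R) (c h : R) (F : R -> R) (t : R) : R :=
  RInt (fun s => G s - friction c (F (Rmax (s - h) 0))) 0 t.

Fixpoint tonelli (G : R -> R) (c h : R) (k : nat) : R -> R :=
  match k with
  | O => fun _ => 0
  | S k => retarded G c h (tonelli G c h k)
  end.

Lemma is_derive_retarded (G : R -> R) (c h : R) (F : R -> R) :
  (forall x, continuous G x) -> (forall x, continuous F x) ->
  forall t, is_derive (retarded G c h F) t (G t - friction c (F (Rmax (t - h) 0))).
Proof.
  intros HG HF t.
  apply (is_derive_RInt_0 (fun s => G s - friction c (F (Rmax (s - h) 0)))).
  intros s. apply (continuous_minus G (fun s => friction c (F (Rmax (s - h) 0)))); trivial.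
  apply continuous_friction.
  apply (continuous_comp (fun s => Rmax (s - h) 0) F); trivial.
  apply continuous_Rmax_0.
  apply (continuous_minus (fun s => s) (fun _ => h)); [apply continuous_id | apply continuous_const].
Qed.

Lemma continuous_tonelli (G : R -> R) (c h : R) :
  (forall x, continuous G x) -> forall k x, continuous (tonelli G c h k) x.
Proof.
  intros HG k. induction k as [|k IH]; intros x; simpl.
  - apply continuous_const.
  - apply (ex_derive_continuous (retarded G c h (tonelli G c h k))).
    eexists. apply is_derive_retarded; trivial.
Qed.

Lemma tonelli_stationary (G : R -> R) (c h : R) (k : nat) (t : R) :
  0 <= h -> 0 <= t <= INR k * h -> tonelli G c h (S k) t = tonelli G c h k t.
Proof.
  intros Hh. revert t. induction k as [|k IH]; intros t Ht.
  - simpl in *. replace t with 0 by lra. apply (@RInt_point R_CompleteNormedModule).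
  - rewrite S_INR in Ht.
    change (retarded G c h (tonelli G c h (S k)) t = retarded G c h (tonelli G c h k) t).
    apply (@RInt_ext R_CompleteNormedModule). intros x Hx.
    rewrite Rmin_left, Rmax_right in Hx by lra.
    rewrite IH; [trivial|]. split; [apply Rmax_r|].
    apply Rmax_lub; [lra|]. apply Rmult_le_pos; [apply pos_INR | trivial].
Qed.

Lemma retarded_solution (G : R -> R) (c : R) (n : nat) :
  (forall x, continuous G x) ->
  exists u, u 0 = 0 /\ forall t, 0 <= t <= 1 ->
    is_derive u t (G t - friction c (u (Rmax (t - / INR (S n)) 0))).
Proof.
  intros HG. pose (h := / INR (S n)).
  assert (Hn : 0 < INR (S n)) by (apply lt_0_INR; apply PeanoNat.Nat.lt_0_succ).
  assert (Hh : 0 < h) by (apply Rinv_0_lt_compat; trivial).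
  assert (E : INR (S n) * h = 1) by (unfold h; field; lra).
  exists (tonelli G c h (S n)). split.
  - apply (@RInt_point R_CompleteNormedModule).
  (* As [t - h <= n h], the iterates [S n] and [n] agree at the delayed argument, so iterate [S n]
     solves the delayed equation with itself in the delayed term. *)
  - intros t Ht. fold h. rewrite tonelli_stationary.
    + apply is_derive_retarded; trivial. intros; apply continuous_tonelli; trivial.
    + lra.
    + rewrite S_INR in E. split; [apply Rmax_r|].
      apply Rmax_lub; [lra|]. apply Rmult_le_pos; [apply pos_INR | lra].
Qed.

Lemma variation_bound (F dF : R -> R) (a b M : R) :
  a <= b -> (forall x, a <= x <= b -> is_derive F x (dF x)) ->
  (forall x, a <= x <= b -> Rabs (dF x) <= M) ->
  Rabs (F b - F a) <= M * (b - a).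
Proof.
  intros Hab HF HM. apply Rabs_le_between. split.
  - assert (H : F a - - M * a <= F b - - M * b); [| lra].
    apply (nondecreasing_of_derive (fun x => F x - - M * x) (fun x => dF x - - M)); trivial.
    + intros x Hx. apply (is_derive_minus F (fun x => - M * x)); [apply HF; trivial|].
      auto_derive; [trivial | ring].
    + intros x Hx. specialize (HM x Hx). apply Rabs_le_between in HM. lra.
  - assert (H : F b - M * b <= F a - M * a); [| lra].
    apply (nonincreasing_of_derive (fun x => F x - M * x) (fun x => dF x - M)); trivial.
    + intros x Hx. apply (is_derive_minus F (fun x => M * x)); [apply HF; trivial|].
      auto_derive; [trivial | ring].
    + intros x Hx. specialize (HM x Hx). apply Rabs_le_between in HM. lra.
Qed.

Definition approximate_solution (G : R -> R) (c e : R) (u : R -> R) : Prop :=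
  u 0 = 0 /\ exists d, forall t, 0 <= t <= 1 ->
    is_derive u t (d t) /\ Rabs (d t - (G t - friction c (u t))) <= e.

Lemma approximate_solution_exists (G : R -> R) (c e M : R) :
  (forall x, continuous G x) -> (forall x, 0 <= G x <= M) -> 0 <= c -> 0 < e ->
  exists u, approximate_solution G c e u.
Proof.
  intros HG HM Hc He.
  (* A Lipschitz constant for the delayed solution [u], because [u <= M]. A delay [h] then moves [u]
     by at most [K h <= d], hence the friction by at most [c sqrt(2 d) <= e]. *)
  pose (K := M + friction c M).
  assert (HK : 0 <= K).
  { assert (H := friction_pos c M Hc). specialize (HM 0). unfold K. lra. }
  destruct (sqrt_small c e Hc He) as [d [Hd Hde]].
  destruct (archimed_cor1 (d / (K + 1))) as [N [HN1 HN2]].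
  { apply Rdiv_lt_0_compat; lra. }
  destruct N as [|n]; [inversion HN2|].
  destruct (retarded_solution G c n HG) as [u [u0 Hu]].
  set (h := / INR (S n)) in *.
  assert (Hh : 0 < h) by (apply Rinv_0_lt_compat, lt_0_INR, PeanoNat.Nat.lt_0_succ).
  assert (HKh : K * h <= d).
  { apply (Rmult_lt_compat_l (K + 1)) in HN1; [|lra].
    replace ((K + 1) * (d / (K + 1))) with d in HN1 by (field; lra). nra. }
  assert (Hup : forall t, 0 <= t <= 1 -> u t <= M).
  { intros t Ht.
    assert (H : u t - M * t <= u 0 - M * 0).
    { apply (nonincreasing_of_derive (fun t => u t - M * t)
        (fun t => G t - friction c (u (Rmax (t - h) 0)) - M)); [lra | |].
      - intros x Hx. apply (is_derive_minus u (fun x => M * x)); [apply Hu; lra|].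
        auto_derive; [trivial | ring].
      - intros x Hx. specialize (HM x).
        assert (B := friction_pos c (u (Rmax (x - h) 0)) Hc). lra. }
    specialize (HM 0). nra. }
  exists u. split; trivial.
  exists (fun t => G t - friction c (u (Rmax (t - h) 0))).
  intros t Ht. split; [apply Hu; trivial|].
  assert (A1 := Rmax_l (t - h) 0). assert (A2 := Rmax_r (t - h) 0).
  assert (A3 : Rmax (t - h) 0 <= t) by (apply Rmax_lub; lra).
  assert (A : Rabs (u t - u (Rmax (t - h) 0)) <= d).
  { apply Rle_trans with (K * (t - Rmax (t - h) 0)).
    - apply (variation_bound u (fun t => G t - friction c (u (Rmax (t - h) 0)))); trivial.
      + intros x Hx. apply Hu. lra.
      + intros x Hx. specialize (HM x).
        assert (B1 := Rmax_l (x - h) 0). assert (B2 := Rmax_r (x - h) 0).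
        assert (B3 : Rmax (x - h) 0 <= x) by (apply Rmax_lub; lra).
        assert (B := friction_pos c (u (Rmax (x - h) 0)) Hc).
        assert (B' : friction c (u (Rmax (x - h) 0)) <= friction c M).
        { apply friction_le; trivial. apply Hup. lra. }
        unfold K. apply Rabs_le_between. lra.
    - apply Rle_trans with (K * h); [apply Rmult_le_compat_l; lra | trivial]. }
  replace (G t - friction c (u (Rmax (t - h) 0)) - (G t - friction c (u t)))
    with (friction c (u t) - friction c (u (Rmax (t - h) 0))) by ring.
  apply Rle_trans with (c * sqrt (2 * d)); [| trivial].
  apply friction_dist; lra.
Qed.

(* The friction term is monotone in u, so two approximate solutions separate at
   most linearly, without any Lipschitz condition. *)
Lemma approximate_solutions_close (G : R -> R) (c e e' : R) (u v : R -> R) :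
  0 <= c -> 0 <= e -> 0 <= e' ->
  approximate_solution G c e u -> approximate_solution G c e' v ->
  forall t, 0 <= t <= 1 -> u t - v t <= e + e'.
Proof.
  intros Hc He He' [u0 [d Hu]] [v0 [d' Hv]] t Ht.
  assert (H : u t - v t - (e + e') * t <= 0).
  { apply Rnot_lt_le; intros Hp.
    assert (H : u t - v t - (e + e') * t <= u 0 - v 0 - (e + e') * 0).
    { apply (positive_part_nonincreasing (fun t => u t - v t - (e + e') * t)
               (fun t => d t - d' t - (e + e'))); [lra | | | trivial].
      - intros x Hx. apply (is_derive_minus (fun x => u x - v x) (fun x => (e + e') * x)).
        + apply (is_derive_minus u v); [apply Hu | apply Hv]; lra.
        + auto_derive; [trivial | ring].
      - intros x Hx Hpx.
        destruct (Hu x) as [_ A]; [lra|]. destruct (Hv x) as [_ B]; [lra|].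
        apply Rabs_le_between in A. apply Rabs_le_between in B.
        assert (friction c (v x) <= friction c (u x)); [| lra].
        apply friction_le; trivial. nra. }
    lra. }
  nra.
Qed.

(** The retraction onto [0,1]. Composition with it turns a function controlled on [0,1] only into
    one that is continuous on the whole line. *)
Definition clamp (x : R) : R := Rmax (1 - Rmax (1 - x) 0) 0.

Lemma clamp_id (x : R) : 0 <= x <= 1 -> clamp x = x.
Proof. intros Hx. unfold clamp. rewrite (Rmax_left (1 - x)), Rmax_left; lra. Qed.

Lemma clamp_range (x : R) : 0 <= clamp x <= 1.
Proof.
  unfold clamp. split; [apply Rmax_r|]. apply Rmax_lub; [| lra].
  assert (H := Rmax_r (1 - x) 0). lra.
Qed.

Lemma continuous_clamp (x : R) : continuous clamp x.
Proof.
  apply continuous_Rmax_0. apply (continuous_minus (fun _ => 1)); [apply continuous_const|].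
  apply continuous_Rmax_0. apply (continuous_minus (fun _ => 1) (fun x => x));
  [apply continuous_const | apply continuous_id].
Qed.

Lemma Rmax_0_lipschitz (x y : R) : Rabs (Rmax x 0 - Rmax y 0) <= Rabs (x - y).
Proof.
  unfold Rmax. destruct (Rle_dec x 0), (Rle_dec y 0); unfold Rabs;
  repeat destruct Rcase_abs; lra.
Qed.

Lemma clamp_lipschitz (x y : R) : Rabs (clamp x - clamp y) <= Rabs (x - y).
Proof.
  unfold clamp. eapply Rle_trans; [apply Rmax_0_lipschitz|].
  replace (1 - Rmax (1 - x) 0 - (1 - Rmax (1 - y) 0))
    with (Rmax (1 - y) 0 - Rmax (1 - x) 0) by ring.
  eapply Rle_trans; [apply Rmax_0_lipschitz|].
  right. f_equal. ring.
Qed.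

Lemma continuous_of_uniform_limit (un : nat -> R -> R) (e : nat -> R) (u : R -> R) :
  (forall n x, continuous (un n) x) -> is_lim_seq e 0 ->
  (forall n x, Rabs (un n x - u x) <= e n) -> forall x, continuous u x.
Proof.
  intros Hc He Hu x. apply continuity_pt_filterlim. intros d Hd.
  destruct (proj2 (is_lim_seq_spec _ _) He (mkposreal _ (Rdiv_lt_0_compat d 3 Hd ltac:(lra)))) as [N HN].
  specialize (HN N (le_n N)). simpl in HN. rewrite Rminus_0_r in HN.
  apply Rabs_def2 in HN.
  assert (C : continuity_pt (un N) x) by (apply continuity_pt_filterlim, Hc).
  destruct (C (d / 3)) as [r [Hr1 Hr2]]; [lra|].
  exists r. split; trivial. intros y Hy. specialize (Hr2 y Hy).
  simpl in *. unfold Rdist in *.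
  assert (A := Hu N x). assert (B := Hu N y).
  apply Rabs_le_between in A. apply Rabs_le_between in B. apply Rabs_def2 in Hr2.
  apply Rabs_def1; lra.
Qed.

(** By [approximate_solutions_close], solutions with defects tending to 0 are uniformly Cauchy on
    [0,1], so no compactness or extraction of subsequences is involved. *)
Lemma energy_solution_exists (G : R -> R) (c M : R) :
  (forall x, continuous G x) -> (forall x, 0 <= G x <= M) -> 0 <= c ->
  exists V, V 0 = 0 /\ forall t, 0 <= t <= 1 -> is_derive V t (G t - friction c (V t)).
Proof.
  intros HG HM Hc.
  assert (Hpos : forall n, 0 < / INR (S n)).
  { intros n. apply Rinv_0_lt_compat, lt_0_INR, PeanoNat.Nat.lt_0_succ. }
  assert (He : is_lim_seq (fun n => / INR (S n)) 0).
  { apply (is_lim_seq_incr_1 (fun n => / INR n)).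
    apply (is_lim_seq_inv INR p_infty); [apply is_lim_seq_INR | easy]. }
  pose (e := fun n => / INR (S n)).
  assert (Hex : forall n, { u | approximate_solution G c (e n) u }).
  { intros n. apply constructive_indefinite_description.
    apply (approximate_solution_exists G c (e n) M); trivial. apply Hpos. }
  pose (un := fun n => proj1_sig (Hex n)).
  assert (Hun : forall n, approximate_solution G c (e n) (un n)).
  { intros n. unfold un. apply (proj2_sig (Hex n)). }
  assert (Hclose : forall n m t, 0 <= t <= 1 -> Rabs (un n t - un m t) <= e n + e m).
  { intros n m t Ht. assert (A := Hpos n). assert (B := Hpos m).
    apply Rabs_le_between. split.
    - assert (H := approximate_solutions_close G c (e m) (e n) (un m) (un n) Hc
        ltac:(unfold e; lra) ltac:(unfold e; lra) (Hun m) (Hun n) t Ht). lra.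
    - apply (approximate_solutions_close G c (e n) (e m)); trivial; unfold e; lra. }
  pose (vn := fun n x => un n (clamp x)).
  assert (Hvc : forall n x, continuous (vn n) x).
  { intros n x. apply (continuous_comp clamp (un n)); [apply continuous_clamp|].
    apply (ex_derive_continuous (un n)). destruct (Hun n) as [_ [d Hd]].
    exists (d (clamp x)). apply Hd, clamp_range. }
  pose (u := fun x => real (Lim_seq (fun n => vn n x))).
  assert (Hlim : forall x, is_lim_seq (fun n => vn n x) (u x)).
  { intros x. apply Lim_seq_correct', ex_lim_seq_cauchy_corr. intros d.
    destruct (proj2 (is_lim_seq_spec _ _) He (pos_div_2 d)) as [N HN].
    exists N. intros n m Hn Hm.
    assert (A := HN n Hn). assert (B := HN m Hm). simpl in A, B.
    rewrite Rminus_0_r in A, B. apply Rabs_def2 in A. apply Rabs_def2 in B.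
    apply Rle_lt_trans with (e n + e m); [apply Hclose, clamp_range|].
    unfold e. simpl. lra. }
  assert (Hu : forall n x, Rabs (vn n x - u x) <= e n).
  { intros n x.
    assert (A : is_lim_seq (fun m => Rabs (vn n x - vn m x)) (Rabs (vn n x - u x))).
    { apply (is_lim_seq_abs _ (Finite (vn n x - u x))).
      apply is_lim_seq_minus'; [apply is_lim_seq_const | apply Hlim]. }
    assert (B : is_lim_seq (fun m => e n + e m) (e n + 0)).
    { apply is_lim_seq_plus'; [apply is_lim_seq_const | apply He]. }
    rewrite Rplus_0_r in B.
    apply (is_lim_seq_le _ _ _ _ (fun m => Hclose n m (clamp x) (clamp_range x)) A B). }
  assert (Huc := continuous_of_uniform_limit vn e u Hvc He Hu).
  (* The limit [u] is so far only continuous. [V] has the derivative that [u] should have, and the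
     two agree on [0,1] because both are limits of the approximations. *)
  pose (V := fun t => RInt (fun s => G s - friction c (u s)) 0 t).
  assert (HV : forall t, is_derive V t (G t - friction c (u t))).
  { intros t. apply (is_derive_RInt_0 (fun s => G s - friction c (u s))).
    intros s. apply (continuous_minus G (fun s => friction c (u s))); trivial.
    apply continuous_friction; trivial. }
  assert (V0 : V 0 = 0) by apply (@RInt_point R_CompleteNormedModule).
  assert (HVu : forall t, 0 <= t <= 1 -> V t = u t).
  { intros t Ht.
    assert (A : forall n, Rabs (vn n t - V t) <= e n + c * sqrt (2 * e n)).
    { intros n. assert (En := Hpos n). fold (e n) in En.
      destruct (Hun n) as [un0 [d Hd]].
      replace (vn n t - V t) with ((un n t - V t) - (un n 0 - V 0))
        by (unfold vn; rewrite (clamp_id t Ht), un0, V0; ring).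
      apply Rle_trans with ((e n + c * sqrt (2 * e n)) * (t - 0)).
      - apply (variation_bound (fun t => un n t - V t)
                 (fun t => d t - (G t - friction c (u t)))); [lra | |].
        + intros x Hx. apply (is_derive_minus (un n) V); [apply Hd; lra | apply HV].
        + intros x Hx. destruct (Hd x) as [_ B]; [lra|].
          assert (D := Hu n x). unfold vn in D. rewrite clamp_id in D by lra.
          apply (friction_dist c _ _ (e n) Hc) in D; [|lra].
          apply Rabs_le_between in B. apply Rabs_le_between in D.
          apply Rabs_le_between. lra.
      - assert (0 <= c * sqrt (2 * e n)).
        { apply Rmult_le_pos; [trivial | apply sqrt_pos]. }
        nra. }
    assert (B : is_lim_seq (fun n => Rabs (vn n t - V t)) (Rabs (u t - V t))).
    { apply (is_lim_seq_abs _ (Finite (u t - V t))).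
      apply is_lim_seq_minus'; [apply Hlim | apply is_lim_seq_const]. }
    assert (C : is_lim_seq (fun n => e n + c * sqrt (2 * e n)) (0 + c * sqrt (2 * 0))).
    { apply is_lim_seq_plus'; [apply He|].
      apply (is_lim_seq_continuous (fun x => c * sqrt (2 * x)) e 0); [| apply He].
      apply continuity_pt_filterlim.
      apply (continuous_scal_r c (fun x : R => sqrt (2 * x))), continuous_sqrt_comp.
      apply (continuous_scal_r 2 (fun x : R => x)), continuous_id. }
    rewrite Rmult_0_r, sqrt_0, Rmult_0_r, Rplus_0_r in C.
    assert (D := is_lim_seq_le _ _ _ _ A B C). simpl in D.
    assert (E := Rabs_pos (u t - V t)).
    destruct (Req_dec (u t - V t) 0) as [Z|Z]; [lra|].
    apply Rabs_pos_lt in Z. lra. }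
  exists V. split; trivial. intros t Ht. rewrite (HVu t Ht). apply HV.
Qed.

Lemma profile_exists (g : R -> R) (c M : R) :
  (forall x, continuous g x) -> (forall x, 0 <= g x <= M) ->
  (forall w, 0 < w < 1 -> 0 < g w) -> 0 <= c ->
  exists P, profile g c P.
Proof.
  intros Hg HM Hpos Hc.
  destruct (energy_solution_exists (fun t => g (1 - t)) c M) as [V [V0 HV]]; trivial.
  { intros x. apply (continuous_comp (fun t => 1 - t) g); [| apply Hg].
    apply (continuous_minus (fun _ => 1) (fun x => x));
      [apply continuous_const | apply continuous_id]. }
  (* Where [V < 0] the friction vanishes and [V' = g >= 0], so [V] cannot descend below its initial
     value 0. *)
  assert (Hnn : forall t, 0 <= t <= 1 -> 0 <= V t).
  { intros t Ht. apply Rnot_lt_le; intros Hn.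
    assert (- V t <= - V 0); [| lra].
    apply (positive_part_nonincreasing (fun t => - V t)
             (fun t => - (g (1 - t) - friction c (V t)))); try lra.
    - intros x Hx. apply (is_derive_opp V). apply HV; lra.
    - intros x Hx Hp. unfold friction. rewrite Rmax_right, Rmult_0_r, sqrt_0 by lra.
      specialize (HM (1 - x)). lra. }
  (* An interior zero would be a minimum of [V], with derivative 0, whereas the equation gives the
     derivative [g (1 - t) > 0] there. *)
  assert (HVp : forall t, 0 < t < 1 -> 0 < V t).
  { intros t Ht. destruct (Hnn t) as [H|E]; [lra | trivial | exfalso].
    assert (D : derivable_pt_lim V t (g (1 - t) - friction c (V t))).
    { apply is_derive_Reals, HV. lra. }
    assert (H := deriv_minimum V 0 1 t (exist _ _ D) (proj1 Ht) (proj2 Ht)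
      (fun x H0 H1 => eq_ind 0 (fun y => y <= V x) (Hnn x (conj (Rlt_le _ _ H0) (Rlt_le _ _ H1))) _ E)).
    simpl in H. unfold friction in H. rewrite <- E, Rmax_left, Rmult_0_r, sqrt_0 in H by lra.
    specialize (Hpos (1 - t)). lra. }
  assert (HVM : forall t, 0 <= t <= 1 -> V t <= M * t).
  { intros t Ht. assert (H : V t - M * t <= V 0 - M * 0); [| lra].
    apply (nonincreasing_of_derive (fun t => V t - M * t)
             (fun t => g (1 - t) - friction c (V t) - M)); [lra | |].
    - intros x Hx. apply (is_derive_minus V (fun x => M * x)); [apply HV; lra|].
      auto_derive; [trivial | ring].
    - intros x Hx. specialize (HM (1 - x)). assert (A := friction_pos c (V x) Hc). lra. }
  exists (fun w => sqrt (2 * V (1 - w))). split.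
  - intros w Hw. assert (Vp := HVp (1 - w) ltac:(lra)).
    assert (Sp : 0 < sqrt (2 * V (1 - w))) by (apply sqrt_lt_R0; lra).
    split; trivial.
    assert (D := HV (1 - w) ltac:(lra)).
    replace (1 - (1 - w)) with w in D by ring.
    assert (Dex : ex_derive V (1 - w)) by (eexists; apply D).
    auto_derive; change (1 + - w) with (1 - w); [split; [trivial | split; [lra | trivial]]|].
    rewrite (is_derive_unique (fun x : R => V x) _ _ D). unfold friction. rewrite Rmax_left by lra.
    field. lra.
  - intros e He. assert (HM0 := HM 0).
    pose (d := Rmin (/ 2) (e ^ 2 / (4 * (M + 1)))).
    assert (Hd : 0 < d /\ d <= / 2 /\ d <= e ^ 2 / (4 * (M + 1))).
    { unfold d. split; [| split]; [| apply Rmin_l | apply Rmin_r].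
      apply Rmin_glb_lt; [lra|]. apply Rdiv_lt_0_compat; nra. }
    exists d. split; [lra|]. intros w Hw.
    rewrite <- (sqrt_pow2 e) by lra.
    assert (A := Hnn (1 - w) ltac:(lra)). assert (B := HVM (1 - w) ltac:(lra)).
    apply sqrt_lt_1_alt. split; [lra|].
    assert (C : d * (4 * (M + 1)) <= e ^ 2).
    { destruct Hd as [_ [_ Hd]]. apply (Rmult_le_compat_r (4 * (M + 1))) in Hd; [|lra].
      replace (e ^ 2 / (4 * (M + 1)) * (4 * (M + 1))) with (e ^ 2) in Hd by (field; lra).
      trivial. }
    assert (0 < e ^ 2) by nra. nra.
Qed.

(** * From waves to profiles and back *)

Lemma decreasing_of_derive (F dF : R -> R) (a b : R) :
  a < b -> (forall x, a <= x <= b -> is_derive F x (dF x)) ->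
  (forall x, a <= x <= b -> dF x < 0) -> F b < F a.
Proof.
  intros Hab HF Hd.
  destruct (MVT_gen F a b dF) as [z [Hz E]].
  - intros x Hx. rewrite Rmin_left, Rmax_right in Hx by lra. apply HF; lra.
  - intros x Hx. rewrite Rmin_left, Rmax_right in Hx by lra.
    apply continuity_pt_filterlim, (ex_derive_continuous F).
    eexists; apply HF; lra.
  - rewrite Rmin_left, Rmax_right in Hz by lra.
    specialize (Hd z Hz). nra.
Qed.

(** [G] is merely a pointwise inverse, later picked by [epsilon]; its continuity at [y] is recovered
    from the monotonicity of [F], whose values at [G y - m] and [G y + m] bracket [y]. The domain
    [D] is the whole line when the wave is inverted and (0,1) when the wave is recovered from
    [X]. *)
Lemma is_derive_inverse (F G : R -> R) (D : R -> Prop) (y l d r : R) :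
  (forall a b, D a -> D b -> a < b -> F b < F a) ->
  0 < d -> (forall y', Rabs (y' - y) < d -> D (G y') /\ F (G y') = y') ->
  0 < r -> (forall x, Rabs (x - G y) <= r -> D x) ->
  is_derive F (G y) l -> l <> 0 -> is_derive G y (/ l).
Proof.
  intros Hdec Hd HG Hr HD HF Hl.
  assert (Hy : Rabs (y - y) < d) by (rewrite Rminus_diag, Rabs_R0; trivial).
  destruct (HG y Hy) as [Dy Ey].
  assert (Hcont : forall e, 0 < e -> exists d', 0 < d' <= d /\
            forall y', Rabs (y' - y) < d' -> Rabs (G y' - G y) < e).
  { intros e He. pose (m := Rmin e r).
    assert (Hm : 0 < m /\ m <= e /\ m <= r).
    { unfold m. split; [apply Rmin_glb_lt; trivial | split; [apply Rmin_l | apply Rmin_r]]. }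
    assert (Dl : D (G y - m)) by (apply HD, Rabs_le_between; lra).
    assert (Dr : D (G y + m)) by (apply HD, Rabs_le_between; lra).
    assert (Fl : y < F (G y - m)).
    { rewrite <- Ey at 1. apply Hdec; trivial; lra. }
    assert (Fr : F (G y + m) < y).
    { rewrite <- Ey at 2. apply Hdec; trivial; lra. }
    pose (d' := Rmin d (Rmin (F (G y - m) - y) (y - F (G y + m)))).
    assert (Hd' : 0 < d' /\ d' <= d /\ d' <= F (G y - m) - y /\ d' <= y - F (G y + m)).
    { unfold d'. repeat split.
      - repeat apply Rmin_glb_lt; lra.
      - apply Rmin_l.
      - eapply Rle_trans; [apply Rmin_r | apply Rmin_l].
      - eapply Rle_trans; [apply Rmin_r | apply Rmin_r]. }
    exists d'. split; [lra|]. intros y' Hy'.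
    destruct (HG y') as [D' E']; [lra|].
    apply Rabs_def2 in Hy'. apply Rabs_def1.
    - apply Rnot_le_lt; intros H.
      destruct (Rle_lt_or_eq_dec (G y + m) (G y')) as [H1|H1]; [lra| |].
      + specialize (Hdec _ _ Dr D' H1). lra.
      + rewrite H1 in Hd'. lra.
    - apply Rnot_le_lt; intros H.
      destruct (Rle_lt_or_eq_dec (G y') (G y - m)) as [H1|H1]; [lra| |].
      + specialize (Hdec _ _ D' Dl H1). lra.
      + rewrite <- H1 in Hd'. lra. }
  apply is_derive_Reals in HF. apply is_derive_Reals. intros e He.
  assert (Cinv : continuity_pt Rinv l).
  { apply continuity_pt_filterlim. apply (continuous_Rinv l); trivial. }
  destruct (Cinv e He) as [e1 [He1 Hinv]].
  destruct (HF e1 He1) as [d1 Hd1].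
  destruct (Hcont d1 (cond_pos d1)) as [d2 [Hd2 Hc]].
  exists (mkposreal d2 (proj1 Hd2)). simpl. intros k Hk Hkd.
  assert (Ek : F (G (y + k)) = y + k).
  { apply HG. replace (y + k - y) with k by ring. lra. }
  pose (h := G (y + k) - G y).
  assert (Hh : h <> 0).
  { unfold h. intros H. apply Hk. replace (G (y + k)) with (G y) in Ek by lra. lra. }
  assert (Hhd : Rabs h < d1).
  { apply Hc. replace (y + k - y) with k by ring. trivial. }
  specialize (Hd1 h Hh Hhd).
  replace (G y + h) with (G (y + k)) in Hd1 by (unfold h; ring).
  rewrite Ek, Ey in Hd1. replace (y + k - y) with k in Hd1 by ring.
  fold h. replace (h / k) with (/ (k / h)) by (field; split; trivial).
  destruct (Req_dec (k / h) l) as [-> | Hne].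
  - rewrite Rminus_diag, Rabs_R0. trivial.
  - apply Hinv. split; [split; [exact I | auto] | exact Hd1].
Qed.

Lemma is_lim_p_infty_eps (W : R -> R) (l : R) :
  is_lim W p_infty l <-> forall e, 0 < e -> exists M, forall x, M < x -> Rabs (W x - l) < e.
Proof.
  rewrite <- is_lim_spec. split.
  - intros H e He. exact (H (mkposreal e He)).
  - intros H e. exact (H e (cond_pos e)).
Qed.

Lemma is_lim_m_infty_eps (W : R -> R) (l : R) :
  is_lim W m_infty l <-> forall e, 0 < e -> exists M, forall x, x < M -> Rabs (W x - l) < e.
Proof.
  rewrite <- is_lim_spec. split.
  - intros H e He. exact (H (mkposreal e He)).
  - intros H e. exact (H e (cond_pos e)).
Qed.

(** This is [P' <= c]. Only the differential part of [profile] is assumed, because [wave_to_profile]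
    applies it before the limits of [P] are known. *)
Lemma profile_minus_linear_nonincreasing (g P : R -> R) (c v w : R) :
  (forall w, 0 < w < 1 -> 0 <= g w) ->
  (forall w, 0 < w < 1 -> 0 < P w /\ is_derive P w (c - g w / P w)) ->
  0 < v -> v <= w -> w < 1 -> P w - c * w <= P v - c * v.
Proof.
  intros Hg HP Hv Hvw Hw.
  apply (nonincreasing_of_derive (fun w => P w - c * w) (fun w => c - g w / P w - c)); trivial.
  - intros x Hx. apply (is_derive_minus P (fun x => c * x)); [apply HP; lra|].
    auto_derive; [trivial | ring].
  - intros x Hx. destruct (HP x) as [Px _]; [lra|].
    assert (0 <= g x / P x); [| lra].
    apply Rmult_le_pos; [apply Hg; lra | left; apply Rinv_0_lt_compat; trivial].
Qed.

(** [P - c w] is nonincreasing and tends to 0 at [w = 0]. *)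
Lemma connecting_le_linear (g P : R -> R) (c : R) :
  (forall w, 0 < w < 1 -> 0 <= g w) -> connecting g c P ->
  forall w, 0 < w < 1 -> P w <= c * w.
Proof.
  intros Hg [[HP _] H0] w Hw. apply Rnot_lt_le; intros H.
  pose (e := (P w - c * w) / 2).
  destruct (H0 e) as [d [Hd Hsmall]]; [unfold e; lra|].
  assert (Hc := Rabs_pos c).
  pose (v := Rmin (Rmin (d / 2) w) (e / (Rabs c + 1))).
  assert (He : 0 < e / (Rabs c + 1)) by (apply Rdiv_lt_0_compat; unfold e; lra).
  assert (Hv : 0 < v /\ v <= d / 2 /\ v <= w /\ v <= e / (Rabs c + 1)).
  { unfold v. repeat split.
    - repeat apply Rmin_glb_lt; lra.
    - eapply Rle_trans; [apply Rmin_l | apply Rmin_l].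
    - eapply Rle_trans; [apply Rmin_l | apply Rmin_r].
    - apply Rmin_r. }
  assert (A := profile_minus_linear_nonincreasing g P c v w Hg HP
                 (proj1 Hv) (proj1 (proj2 (proj2 Hv))) (proj2 Hw)).
  specialize (Hsmall v).
  assert (B : v * (Rabs c + 1) <= e).
  { destruct Hv as [_ [_ [_ Hv]]]. apply (Rmult_le_compat_r (Rabs c + 1)) in Hv; [|lra].
    replace (e / (Rabs c + 1) * (Rabs c + 1)) with e in Hv by (field; lra). trivial. }
  assert (C := Rle_abs (- c)). rewrite Rabs_Ropp in C.
  assert (e = (P w - c * w) / 2) by reflexivity. nra.
Qed.

Lemma wave_decreasing (g W : R -> R) (c a b : R) :
  travelling_wave g c W -> a < b -> W b < W a.
Proof.
  intros [Hex [_ [_ [_ Hneg]]]] Hab.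
  apply (decreasing_of_derive W (Derive W)); trivial.
  intros x _. apply Derive_correct, Hex.
Qed.

Lemma wave_range (g W : R -> R) (c x : R) : travelling_wave g c W -> 0 < W x < 1.
Proof.
  intros HW. assert (Hdec := fun a b => wave_decreasing g W c a b HW).
  assert (Hp := proj1 (is_lim_p_infty_eps W 0) (proj1 (proj2 (proj2 (proj2 HW))))).
  assert (Hm := proj1 (is_lim_m_infty_eps W 1) (proj1 (proj2 (proj2 HW)))).
  split; apply Rnot_le_lt; intros H.
  - assert (A := Hdec x (x + 1) ltac:(lra)).
    destruct (Hp (- W (x + 1))) as [M HM]; [lra|].
    assert (B1 := Rmax_l (M + 1) (x + 2)). assert (B2 := Rmax_r (M + 1) (x + 2)).
    set (y := Rmax (M + 1) (x + 2)) in *.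
    assert (B := Hdec (x + 1) y ltac:(lra)).
    specialize (HM y ltac:(lra)). apply Rabs_def2 in HM. lra.
  - assert (A := Hdec (x - 1) x ltac:(lra)).
    destruct (Hm (W (x - 1) - 1)) as [M HM]; [lra|].
    assert (B1 := Rmin_l (M - 1) (x - 2)). assert (B2 := Rmin_r (M - 1) (x - 2)).
    set (y := Rmin (M - 1) (x - 2)) in *.
    assert (B := Hdec y (x - 1) ltac:(lra)).
    specialize (HM y ltac:(lra)). apply Rabs_def2 in HM. lra.
Qed.

Lemma wave_surjective (g W : R -> R) (c w : R) :
  travelling_wave g c W -> 0 < w < 1 -> exists x, W x = w.
Proof.
  intros HW Hw. assert (Hdec := wave_decreasing g W c).
  assert (Hp := proj1 (is_lim_p_infty_eps W 0) (proj1 (proj2 (proj2 (proj2 HW))))).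
  assert (Hm := proj1 (is_lim_m_infty_eps W 1) (proj1 (proj2 (proj2 HW)))).
  destruct (Hp w) as [M HM]; [lra|]. destruct (Hm (1 - w)) as [M' HM']; [lra|].
  specialize (HM (M + 1) ltac:(lra)). specialize (HM' (M' - 1) ltac:(lra)).
  apply Rabs_def2 in HM. apply Rabs_def2 in HM'.
  assert (M' - 1 <= M + 1).
  { apply Rnot_lt_le; intros H. specialize (Hdec _ _ HW H). lra. }
  destruct (first_zero (fun x => W x - w) (M' - 1) (M + 1)) as [z [_ [E _]]]; try lra.
  - intros x _. apply (continuous_minus W (fun _ => w)); [| apply continuous_const].
    apply (ex_derive_continuous W). apply (proj1 HW).
  - exists z. lra.
Qed.

Definition wave_inverse (W P X : R -> R) : Prop :=
  (forall w, 0 < w < 1 -> is_derive X w (- / P w) /\ W (X w) = w) /\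
  (forall x, 0 < W x < 1 /\ X (W x) = x).

(** The profile vanishes at both ends because the wave lives on the whole line: if [P] did not tend
    to 0, then [P' <= c] would keep it above a positive constant near that end, and the end would be
    reached at a finite position. *)
Lemma wave_to_profile (g W : R -> R) (c : R) :
  (forall w, 0 < w < 1 -> 0 <= g w) -> travelling_wave g c W ->
  exists P X, connecting g c P /\ wave_inverse W P X.
Proof.
  intros Hg HW. assert (Hdec := fun a b => wave_decreasing g W c a b HW).
  assert (Hrange := fun x => wave_range g W c x HW).
  assert (Hex := proj1 HW). assert (Hode := proj1 (proj2 HW)).
  assert (Hneg := proj2 (proj2 (proj2 (proj2 HW)))).
  pose (X := fun w => epsilon (inhabits 0) (fun x => W x = w)).
  assert (HX : forall w, 0 < w < 1 -> W (X w) = w).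
  { intros w Hw. apply (epsilon_spec (inhabits 0) (fun x => W x = w)).
    apply (wave_surjective g W c); trivial. }
  assert (Hinj : forall x y, W x = W y -> x = y).
  { intros x y E. destruct (Rtotal_order x y) as [H|[H|H]]; trivial;
    apply Hdec in H; lra. }
  assert (HXW : forall x, X (W x) = x) by (intros x; apply Hinj, HX, Hrange).
  pose (P := fun w => - Derive W (X w)).
  assert (Ppos : forall w, 0 < P w) by (intros w; unfold P; specialize (Hneg (X w)); lra).
  assert (DX : forall w, 0 < w < 1 -> is_derive X w (- / P w)).
  { intros w Hw. replace (- / P w) with (/ (Derive W (X w))).
    2: { unfold P. field. specialize (Hneg (X w)). lra. }
    apply (is_derive_inverse W X (fun _ => True) w _ (Rmin w (1 - w)) 1); try easy.
    - intros; apply Hdec; trivial.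
    - apply Rmin_glb_lt; lra.
    - intros y Hy. split; trivial. apply HX.
      assert (A := Rmin_l w (1 - w)). assert (B := Rmin_r w (1 - w)).
      apply Rabs_def2 in Hy. lra.
    - lra.
    - apply Derive_correct, Hex.
    - specialize (Hneg (X w)). lra. }
  assert (DP : forall w, 0 < w < 1 -> 0 < P w /\ is_derive P w (c - g w / P w)).
  { intros w Hw. split; [apply Ppos|].
    assert (D2 : is_derive (Derive W) (X w) (Derive_n W 2 (X w))).
    { apply (Derive_correct (Derive W)). exact (proj2 (Hex (X w))). }
    assert (D := is_derive_opp _ _ _
                   (is_derive_comp (Derive W) X w _ _ D2 (DX w Hw))).
    evar_last; [exact D|].
    specialize (Hode (X w)). rewrite (HX w Hw) in Hode.
    change (- (- / P w * Derive_n W 2 (X w)) = c - g w / P w).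
    assert (E : Derive_n W 2 (X w) = c * P w - g w) by (unfold P; lra).
    rewrite E. field. specialize (Ppos w). lra. }
  (* While the speed [P] is at least [e], the wave covers the values from [a] to [b] within a length
     of at most [(b - a) / e]. *)
  assert (XB : forall e a b, 0 < e -> 0 < a -> a <= b -> b < 1 ->
            (forall w, a <= w <= b -> e <= P w) -> X a <= X b + (b - a) / e).
  { intros e a b He Ha Hab Hb HeP.
    assert (H : X a + a / e <= X b + b / e).
    { apply (nondecreasing_of_derive (fun w => X w + w / e) (fun w => - / P w + / e)); trivial.
      - intros x Hx. apply (is_derive_plus X (fun x => x / e)); [apply DX; lra|].
        auto_derive; [trivial | field; lra].
      - intros x Hx. specialize (HeP x Hx).
        assert (/ P x <= / e) by (apply Rinv_le_contravar; lra). lra. }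
    unfold Rdiv in *. lra. }
  assert (Hlin := fun v w => profile_minus_linear_nonincreasing g P c v w Hg DP).
  assert (Hc := Rle_abs c). assert (Hc' := Rle_abs (- c)). rewrite Rabs_Ropp in Hc'.
  exists P, X. split; [split; [split; [trivial|] |] |].
  - intros e He. apply NNPP; intros Hn.
    (* Over a length [d] the bound [P' <= c] lets [P] rise by at most [e / 2], so one value below
       [e / 2] would keep [P < e] up to 1. *)
    pose (d := Rmin (/ 2) (e / (2 * (Rabs c + 1)))).
    assert (Hd0 : 0 < e / (2 * (Rabs c + 1))) by (apply Rdiv_lt_0_compat; lra).
    assert (Hd : 0 < d /\ d <= / 2 /\ d <= e / (2 * (Rabs c + 1))).
    { unfold d. split; [apply Rmin_glb_lt; lra | split; [apply Rmin_l | apply Rmin_r]]. }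
    assert (Hde : (Rabs c + 1) * d <= e / 2).
    { destruct Hd as [_ [_ Hd]]. apply (Rmult_le_compat_l (Rabs c + 1)) in Hd; [|lra].
      replace ((Rabs c + 1) * (e / (2 * (Rabs c + 1)))) with (e / 2) in Hd by (field; lra).
      trivial. }
    assert (HPe : forall v, 1 - d <= v < 1 -> e / 2 <= P v).
    { intros v Hv. apply Rnot_lt_le; intros Hlt. apply Hn.
      exists (1 - v). split; [lra|]. intros w Hw.
      specialize (Hlin v w). nra. }
    (* This point is too far to the left: at speed at least [e / 2], the values above [1 - d] fill a
       length of at most [2 / e]. *)
    pose (x := X (1 - d) - 2 / e - 1).
    assert (H2e : 0 < 2 / e) by (apply Rdiv_lt_0_compat; lra).
    assert (Hx : 1 - d < W x).
    { rewrite <- (HX (1 - d)) by lra. apply Hdec. unfold x. lra. }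
    assert (HB := XB (e / 2) (1 - d) (W x) ltac:(lra) ltac:(lra) ltac:(lra)
              (proj2 (Hrange x))).
    rewrite HXW in HB.
    assert (X (1 - d) <= x + (W x - (1 - d)) / (e / 2)).
    { apply HB. intros w Hw. apply HPe. specialize (Hrange x). lra. }
    assert ((W x - (1 - d)) / (e / 2) <= 2 / e).
    { replace ((W x - (1 - d)) / (e / 2)) with ((W x - (1 - d)) * (2 / e)) by (field; lra).
      specialize (Hrange x). nra. }
    unfold x in *. lra.
  - intros e He. apply NNPP; intros Hn.
    pose (d := Rmin (/ 2) (e / (2 * (Rabs c + 1)))).
    assert (Hd0 : 0 < e / (2 * (Rabs c + 1))) by (apply Rdiv_lt_0_compat; lra).
    assert (Hd : 0 < d /\ d <= / 2 /\ d <= e / (2 * (Rabs c + 1))).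
    { unfold d. split; [apply Rmin_glb_lt; lra | split; [apply Rmin_l | apply Rmin_r]]. }
    assert (Hde : (Rabs c + 1) * d <= e / 2).
    { destruct Hd as [_ [_ Hd]]. apply (Rmult_le_compat_l (Rabs c + 1)) in Hd; [|lra].
      replace ((Rabs c + 1) * (e / (2 * (Rabs c + 1)))) with (e / 2) in Hd by (field; lra).
      trivial. }
    assert (Hw0 : exists w0, 0 < w0 < d /\ e <= P w0).
    { apply NNPP; intros Hn'. apply Hn. exists d. split; [lra|]. intros w Hw.
      apply Rnot_le_lt; intros H. apply Hn'. exists w. split; lra. }
    destruct Hw0 as [w0 [Hw0 HPw0]].
    assert (HPe : forall v, 0 < v <= w0 -> e / 2 <= P v).
    { intros v Hv. specialize (Hlin v w0). nra. }
    pose (x := X w0 + 2 / e + 1).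
    assert (H2e : 0 < 2 / e) by (apply Rdiv_lt_0_compat; lra).
    assert (Hx : W x < w0).
    { rewrite <- (HX w0) by lra. apply Hdec. unfold x. lra. }
    assert (HB := XB (e / 2) (W x) w0 ltac:(lra) (proj1 (Hrange x)) ltac:(lra) ltac:(lra)).
    rewrite HXW in HB.
    assert (x <= X w0 + (w0 - W x) / (e / 2)).
    { apply HB. intros w Hw. apply HPe. specialize (Hrange x). lra. }
    assert ((w0 - W x) / (e / 2) <= 2 / e).
    { replace ((w0 - W x) / (e / 2)) with ((w0 - W x) * (2 / e)) by (field; lra).
      specialize (Hrange x). nra. }
    unfold x in *. lra.
  - split.
    + intros w Hw. split; [apply DX; trivial | apply HX; trivial].
    + intros x. split; [apply Hrange | apply HXW].
Qed.

(** The line [K (1 - w)] is a supersolution: its derivative is [- K <= -1], while [g] divided by the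
    line is at most 1. *)
Lemma profile_le_near_1 (g P : R -> R) (c K : R) :
  (forall w, 0 < w < 1 -> 0 <= g w <= K * (1 - w)) -> 0 <= c -> 1 <= K ->
  profile g c P -> forall w, 0 < w < 1 -> P w <= K * (1 - w).
Proof.
  intros Hg Hc HK HP w Hw.
  apply (profile_le_supersolution g P (fun w => K * (1 - w)) c); trivial.
  - intros v Hv. apply Hg; trivial.
  - intros b Hb v Hv. split; [nra|]. exists (- K). split.
    + auto_derive; [trivial | ring].
    + assert (H : g v / (K * (1 - v)) <= 1); [| lra].
      apply Rle_div_l; [nra|]. rewrite Rmult_1_l. apply Hg. lra.
Qed.

(** The wave is the inverse of [X = - int dv / P]. The linear bounds [P <= c w] and [P <= K (1 - w)]
    make this integral diverge logarithmically at both ends, so [X] maps (0,1) onto the whole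
    line. *)
Lemma profile_to_wave (g P : R -> R) (c K : R) :
  (forall w, 0 < w < 1 -> 0 <= g w <= K * (1 - w)) -> 0 < c -> 1 <= K ->
  connecting g c P -> exists W, travelling_wave g c W.
Proof.
  intros Hg Hc HK HP.
  assert (Hg0 : forall w, 0 < w < 1 -> 0 <= g w) by (intros w Hw; apply Hg; trivial).
  assert (Hlin := connecting_le_linear g P c Hg0 HP).
  assert (Hlin1 := profile_le_near_1 g P c K Hg (Rlt_le _ _ Hc) HK (proj1 HP)).
  assert (DP := proj1 (proj1 HP)).
  assert (Pc : forall w, 0 < w < 1 -> continuous (fun v => / P v) w).
  { intros w Hw. destruct (DP w Hw) as [Pp D].
    apply continuous_Rinv_comp; [| lra].
    apply (ex_derive_continuous P). eexists; apply D. }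
  pose (X := fun w => - RInt (fun v => / P v) (/ 2) w).
  assert (DX : forall w, 0 < w < 1 -> is_derive X w (- / P w)).
  { intros w Hw. apply (is_derive_opp (fun w => RInt (fun v => / P v) (/ 2) w)).
    apply (is_derive_RInt (fun v => / P v) (fun w => RInt (fun v => / P v) (/ 2) w) (/ 2) w);
      [| apply Pc; trivial].
    assert (Hr : 0 < Rmin w (1 - w)) by (apply Rmin_glb_lt; lra).
    exists (mkposreal _ Hr). intros y Hy.
    change (Rabs (y - w) < Rmin w (1 - w)) in Hy. apply Rabs_def2 in Hy.
    assert (A := Rmin_l w (1 - w)). assert (B := Rmin_r w (1 - w)).
    apply (@RInt_correct R_CompleteNormedModule).
    apply (@ex_RInt_continuous R_CompleteNormedModule).
    intros z Hz. apply Pc. split.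
    - eapply Rlt_le_trans; [| apply Hz]. apply Rmin_glb_lt; lra.
    - eapply Rle_lt_trans; [apply Hz|]. apply Rmax_lub_lt; lra. }
  assert (Pinv : forall w, 0 < w < 1 -> 0 < / P w).
  { intros w Hw. apply Rinv_0_lt_compat, DP; trivial. }
  assert (Xdec : forall a b, 0 < a < 1 -> 0 < b < 1 -> a < b -> X b < X a).
  { intros a b Ha Hb Hab. apply (decreasing_of_derive X (fun w => - / P w)); trivial.
    - intros x Hx. apply DX. lra.
    - intros x Hx. specialize (Pinv x). lra. }
  assert (Xtop : forall m, exists w, 0 < w < / 2 /\ m < X w).
  { intros m.
    destruct (ln_unbounded_below (c * (X (/ 2) + / c * ln (/ 2) - m))) as [w [Hw Hl]].
    pose (v := Rmin w (/ 4)).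
    assert (Hv : 0 < v /\ v <= w /\ v <= / 4).
    { unfold v. split; [apply Rmin_glb_lt; lra | split; [apply Rmin_l | apply Rmin_r]]. }
    exists v. split; [lra|]. specialize (Hl v ltac:(lra)).
    assert (H : X (/ 2) + / c * ln (/ 2) <= X v + / c * ln v).
    { apply (nonincreasing_of_derive (fun w => X w + / c * ln w)
               (fun w => - / P w + / c * / w)); [lra | |].
      - intros x Hx. apply (is_derive_plus X (fun x => / c * ln x)); [apply DX; lra|].
        apply is_derive_scal, is_derive_ln. lra.
      - intros x Hx. rewrite <- Rinv_mult.
        assert (/ (c * x) <= / P x); [| lra].
        apply Rinv_le_contravar; [apply DP; lra | apply Hlin; lra]. }
    apply (Rmult_lt_compat_l (/ c)) in Hl; [| apply Rinv_0_lt_compat; trivial].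
    rewrite <- Rmult_assoc, Rinv_l, Rmult_1_l in Hl by lra. lra. }
  assert (Xbot : forall m, exists w, / 2 < w < 1 /\ X w < m).
  { intros m.
    destruct (ln_unbounded_below (K * (m - X (/ 2) + / K * ln (1 - / 2)))) as [w [Hw Hl]].
    pose (v := Rmin w (/ 4)).
    assert (Hv : 0 < v /\ v <= w /\ v <= / 4).
    { unfold v. split; [apply Rmin_glb_lt; lra | split; [apply Rmin_l | apply Rmin_r]]. }
    exists (1 - v). split; [lra|]. specialize (Hl v ltac:(lra)).
    assert (H : X (1 - v) - / K * ln (1 - (1 - v)) <= X (/ 2) - / K * ln (1 - / 2)).
    { apply (nonincreasing_of_derive (fun w => X w - / K * ln (1 - w))
               (fun w => - / P w - / K * - / (1 - w))); [lra | |].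
      - intros x Hx. apply (is_derive_minus X (fun x => / K * ln (1 - x))); [apply DX; lra|].
        apply is_derive_scal. auto_derive; [lra | field; lra].
      - intros x Hx.
        assert (/ (K * (1 - x)) <= / P x).
        { apply Rinv_le_contravar; [apply DP; lra | apply Hlin1; lra]. }
        rewrite Rinv_mult in *. lra. }
    replace (1 - (1 - v)) with v in H by ring.
    apply (Rmult_lt_compat_l (/ K)) in Hl; [| apply Rinv_0_lt_compat; lra].
    rewrite <- Rmult_assoc, Rinv_l, Rmult_1_l in Hl by lra. lra. }
  pose (W := fun x => epsilon (inhabits 0) (fun w => 0 < w < 1 /\ X w = x)).
  assert (HW : forall x, 0 < W x < 1 /\ X (W x) = x).
  { intros x. apply (epsilon_spec (inhabits 0) (fun w => 0 < w < 1 /\ X w = x)).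
    destruct (Xtop x) as [a [Ha1 Ha2]]. destruct (Xbot x) as [b [Hb1 Hb2]].
    destruct (first_zero (fun w => X w - x) a b) as [z [Hz [E _]]]; try lra.
    - intros w Hw. apply (continuous_minus X (fun _ => x)); [| apply continuous_const].
      apply (ex_derive_continuous X). eexists. apply DX. lra.
    - exists z. split; lra. }
  assert (DW : forall x, is_derive W x (- P (W x))).
  { intros x. destruct (HW x) as [Hr _]. destruct (DP (W x) Hr) as [Pp _].
    replace (- P (W x)) with (/ (- / P (W x))) by (field; lra).
    assert (A := Rmin_l (W x) (1 - W x)). assert (B := Rmin_r (W x) (1 - W x)).
    assert (C : 0 < Rmin (W x) (1 - W x)) by (apply Rmin_glb_lt; lra).
    apply (is_derive_inverse X W (fun w => 0 < w < 1) x _ 1 (Rmin (W x) (1 - W x) / 2)).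
    - exact Xdec.
    - lra.
    - intros y _. apply HW.
    - lra.
    - intros w Hw. apply Rabs_le_between in Hw. lra.
    - apply DX; trivial.
    - specialize (Pinv _ Hr). lra. }
  assert (EW : forall x, Derive W x = - P (W x)).
  { intros x. apply is_derive_unique, DW. }
  assert (DDW : forall x, is_derive (Derive W) x (- (- P (W x) * (c - g (W x) / P (W x))))).
  { intros x. apply (is_derive_ext (fun x => - P (W x))).
    - intros t. symmetry. apply EW.
    - apply (is_derive_opp (fun x => P (W x))).
      apply (is_derive_comp P W x (c - g (W x) / P (W x)) (- P (W x))).
      + apply DP, HW.
      + apply DW. }
  exists W. split; [| split; [| split; [| split]]].
  - intros x. split; [eexists; apply DW | eexists; apply DDW].
  - intros x. change (Derive (Derive W) x + c * Derive W x + g (W x) = 0).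
    rewrite (is_derive_unique _ _ _ (DDW x)), EW. destruct (DP (W x)) as [Pp _]; [apply HW|].
    field. lra.
  - apply is_lim_m_infty_eps. intros e He.
    pose (w := Rmax (/ 2) (1 - e)).
    assert (Hw : / 2 <= w < 1 /\ 1 - e <= w).
    { unfold w. split; [split|]; [apply Rmax_l | apply Rmax_lub_lt; lra | apply Rmax_r]. }
    exists (X w). intros x Hx. destruct (HW x) as [Hr E].
    assert (w < W x).
    { apply Rnot_le_lt; intros [H|H].
      - specialize (Xdec (W x) w). lra.
      - rewrite H in E. lra. }
    apply Rabs_def1; lra.
  - apply is_lim_p_infty_eps. intros e He.
    pose (w := Rmin (/ 2) e).
    assert (Hw : 0 < w <= / 2 /\ w <= e).
    { unfold w. split; [split|]; [apply Rmin_glb_lt; lra | apply Rmin_l | apply Rmin_r]. }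
    exists (X w). intros x Hx. destruct (HW x) as [Hr E].
    assert (W x < w).
    { apply Rnot_le_lt; intros [H|H].
      - specialize (Xdec w (W x)). lra.
      - rewrite <- H in E. lra. }
    apply Rabs_def1; lra.
  - intros x. rewrite EW. destruct (DP (W x)) as [Pp _]; [apply HW|]. lra.
Qed.

(** * Behaviour of profiles at w = 0 *)

(** Second-order contact with [w], under the normalization [g'(0) = 1]. The constant is explicit so
    that neighbouring parameters can share it. *)
Definition linear_at_0 (K : R) (g : R -> R) : Prop :=
  0 < K /\ forall w, 0 < w < 1 -> 0 <= g w /\ Rabs (g w - w) <= K * w ^ 2.

Definition slope (P : R -> R) (w : R) : R := P w / w.

Lemma slope_equation (g P : R -> R) (c K w : R) :
  linear_at_0 K g -> profile g c P -> 0 < w < 1 ->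
  0 < slope P w /\ Rabs (g w / w - 1) <= K * w /\
  is_derive (slope P) w ((c - slope P w - (g w / w) / slope P w) / w).
Proof.
  intros [HK Hg] [HP _] Hw. destruct (HP w Hw) as [Pp D].
  assert (Sp : 0 < slope P w) by (apply Rdiv_lt_0_compat; lra).
  split; [trivial | split].
  - destruct (Hg w Hw) as [_ H].
    replace (g w / w - 1) with ((g w - w) * / w) by (field; lra).
    rewrite Rabs_mult, (Rabs_right (/ w)) by (left; apply Rinv_0_lt_compat; lra).
    apply Rle_div_l; [lra|]. lra.
  - unfold slope. assert (ex_derive P w) by (eexists; apply D).
    auto_derive; [split; [trivial | split; [lra | trivial]]|].
    rewrite (is_derive_unique (fun x : R => P x) _ _ D). field. lra.
Qed.

Lemma small_multiple (a b : R) : 0 <= a -> 0 < b -> exists w, 0 < w < 1 /\ a * w <= b.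
Proof.
  intros Ha Hb. exists (Rmin (/ 2) (b / (a + 1))).
  assert (A := Rmin_l (/ 2) (b / (a + 1))). assert (B := Rmin_r (/ 2) (b / (a + 1))).
  assert (C : 0 < b / (a + 1)) by (apply Rdiv_lt_0_compat; lra).
  assert (D : 0 < Rmin (/ 2) (b / (a + 1))) by (apply Rmin_glb_lt; lra).
  split; [lra|].
  apply (Rmult_le_compat_l (a + 1)) in B; [|lra].
  replace ((a + 1) * (b / (a + 1))) with b in B by (field; lra). lra.
Qed.

Lemma slope_le_speed (g P : R -> R) (c K w : R) :
  linear_at_0 K g -> connecting g c P -> 0 < w < 1 -> slope P w <= c.
Proof.
  intros [_ Hg] HP Hw. apply Rle_div_l; [lra|].
  apply (connecting_le_linear g P c); trivial. intros v Hv. apply Hg; trivial.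
Qed.

(** Since [q + 1/q >= 2], for [c < 2] the quantity [w q'] is below a negative constant near 0, and
    [q] would be unbounded, against [q <= c]. *)
Lemma connecting_speed_ge_2 (g P : R -> R) (c K : R) :
  linear_at_0 K g -> connecting g c P -> 2 <= c.
Proof.
  intros Hg HP. apply Rnot_lt_le; intros Hc.
  assert (Hc0 : 0 < c).
  { destruct (slope_equation g P c K (/ 2) Hg (proj1 HP)) as [H _]; [lra|].
    assert (A := slope_le_speed g P c K (/ 2) Hg HP ltac:(lra)). lra. }
  pose (d := (2 - c) / 2).
  destruct (small_multiple K (d / 2)) as [w1 [Hw1 Hs]];
    [apply Rlt_le, Hg | unfold d; lra |].
  apply (no_logarithmic_growth (slope P)
    (fun w => (c - slope P w - (g w / w) / slope P w) / w) w1 d c); try (unfold d; lra).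
  - intros w Hw.
    destruct (slope_equation g P c K w Hg (proj1 HP)) as [Sp [Hr D]]; [lra|].
    split; trivial.
    apply Rmult_le_compat_r; [left; apply Rinv_0_lt_compat; lra|].
    apply Rabs_le_between in Hr. destruct Hg as [HK _].
    assert (K * w <= d / 2) by nra.
    set (q := slope P w) in *. set (r := g w / w) in *.
    assert (c - q + d <= r / q); [| lra].
    apply Rle_div_r; [trivial|].
    (* The maximum of [q (2 - d - q)] is [(1 - d/2)^2], which is at most [1 - d/2 <= r]. *)
    assert (c + d = 2 - d) by (unfold d; lra).
    assert (0 < d < 1) by (unfold d; lra).
    assert (A := pow2_ge_0 (q - (1 - d / 2))). nra.
  - intros w Hw. apply (slope_le_speed g P c K); trivial. lra.
Qed.

(** Above the line [1 + K w] the excess [Y] satisfies [w Y' <= - (q - 1)^2 / 2]: it grows towards 0,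
    at a logarithmic rate at least, against [q <= 2]. *)
Lemma slope_upper (g P : R -> R) (K w : R) :
  linear_at_0 K g -> connecting g 2 P -> 0 < w < 1 -> slope P w <= 1 + K * w.
Proof.
  intros Hg HP Hw1. apply Rnot_lt_le; intros Hn.
  assert (HK := proj1 Hg).
  pose (Y := fun w => slope P w - (1 + K * w)).
  pose (y := fun w => (2 - slope P w - (g w / w) / slope P w) / w - K).
  assert (DY : forall v, 0 < v < 1 -> is_derive Y v (y v)).
  { intros v Hv. apply (is_derive_minus (slope P) (fun v => 1 + K * v)).
    - apply (slope_equation g P 2 K v Hg (proj1 HP) Hv).
    - auto_derive; [trivial | ring]. }
  assert (Hy : forall v, 0 < v < 1 -> 0 < Y v -> y v <= - ((slope P v - 1) ^ 2 / 2) / v).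
  { intros v Hv HYv. unfold y, Y in *.
    destruct (slope_equation g P 2 K v Hg (proj1 HP) Hv) as [Sp [Hr _]].
    assert (S2 := slope_le_speed g P 2 K v Hg HP Hv).
    apply Rabs_le_between in Hr.
    set (q := slope P v) in *. set (r := g v / v) in *.
    (* Multiplied by [q], with [r >= 1 - K v], this leaves
       [(q - 1)^2 (2 - q) / 2 + K v (q - 1) >= 0], true for [1 <= q <= 2]. *)
    assert (2 - q - r / q - K * v <= - ((q - 1) ^ 2 / 2)).
    { assert (2 - q - K * v + (q - 1) ^ 2 / 2 <= r / q); [| lra].
      apply Rle_div_r; [trivial|].
      assert (0 < K * v) by nra.
      assert (0 <= (q - 1) ^ 2 * (2 - q)) by (apply Rmult_le_pos; [apply pow2_ge_0 | lra]).
      nra. }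
    apply Rle_div_r; [lra|].
    replace (((2 - q - r / q) / v - K) * v) with (2 - q - r / q - K * v) by (field; lra).
    trivial. }
  assert (Hmono : forall v, 0 < v <= w -> Y w <= Y v).
  { intros v Hv. apply (positive_part_nonincreasing Y y); try lra.
    - intros x Hx. apply DY. lra.
    - intros x Hx Hp. specialize (Hy x ltac:(lra) Hp).
      eapply Rle_trans; [apply Hy|]. unfold Rdiv.
      assert (0 < / x) by (apply Rinv_0_lt_compat; lra).
      assert (A := pow2_ge_0 (slope P x - 1)). nra.
    - unfold Y. lra. }
  assert (HYw : 0 < Y w) by (unfold Y; lra).
  apply (no_logarithmic_growth Y y w ((Y w) ^ 2 / 2) 2); try lra.
  - assert (0 < Y w ^ 2) by (apply pow_lt; trivial). lra.
  - intros v Hv. split; [apply DY; lra|]. specialize (Hmono v Hv).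
    eapply Rle_trans; [apply Hy; lra|].
    apply Rmult_le_compat_r; [left; apply Rinv_0_lt_compat; lra|].
    assert (Y w <= slope P v - 1) by (unfold Y in *; nra). nra.
  - intros v Hv. assert (A := slope_le_speed g P 2 K v Hg HP ltac:(lra)).
    unfold Y. nra.
Qed.

(** Below 9/10 the slope increases towards 0 at a logarithmic rate: it cannot remain there, and once
    above 9/10 it cannot fall back as [w] decreases. *)
Lemma slope_lower_eventually (g P : R -> R) (K : R) :
  linear_at_0 K g -> connecting g 2 P ->
  exists w0, 0 < w0 < 1 /\ forall w, 0 < w <= w0 -> 9 / 10 <= slope P w.
Proof.
  intros Hg HP. assert (HK := proj1 Hg).
  (* For [q < 9/10], [q (2 - q + 1/200)] is below its value 0.9945 at 9/10, hence below
     [1 - 1/200 <= r]. *)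
  destruct (small_multiple K (1 / 200)) as [w1 [Hw1 Hs]]; [lra | lra |].
  pose (y := fun w => (2 - slope P w - (g w / w) / slope P w) / w).
  assert (Hy : forall w, 0 < w <= w1 -> is_derive (slope P) w (y w) /\
            (slope P w < 9 / 10 -> y w <= - (1 / 200) / w)).
  { intros w Hw.
    destruct (slope_equation g P 2 K w Hg (proj1 HP)) as [Sp [Hr D]]; [lra|].
    split; trivial. intros Hq.
    apply Rmult_le_compat_r; [left; apply Rinv_0_lt_compat; lra|].
    apply Rabs_le_between in Hr. assert (K * w <= 1 / 200) by nra.
    set (q := slope P w) in *. set (r := g w / w) in *.
    assert (2 - q + 1 / 200 <= r / q); [| lra].
    apply Rle_div_r; [trivial|]. nra. }
  assert (Hex : exists w2, 0 < w2 <= w1 /\ 9 / 10 <= slope P w2).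
  { apply NNPP; intros Hn.
    assert (Hlt : forall w, 0 < w <= w1 -> slope P w < 9 / 10).
    { intros w Hw. apply Rnot_le_lt; intros H. apply Hn. exists w. split; trivial. }
    apply (no_logarithmic_growth (slope P) y w1 (1 / 200) (9 / 10)); try lra.
    - intros w Hw. split; apply Hy; trivial. apply Hlt; trivial.
    - intros w Hw. left. apply Hlt; trivial. }
  destruct Hex as [w2 [Hw2 H2]]. exists w2. split; [lra|]. intros w Hw.
  apply Rnot_lt_le; intros Hn.
  assert (9 / 10 - slope P w <= 9 / 10 - slope P w2); [| lra].
  apply (positive_part_nondecreasing (fun w => 9 / 10 - slope P w) (fun w => 0 - y w)); try lra.
  - intros x Hx. apply (is_derive_minus (fun _ => 9 / 10) (slope P)).
    + exact (is_derive_const (9 / 10) x).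
    + apply Hy. lra.
  - intros x Hx Hp. destruct (Hy x) as [_ A]; [lra|]. specialize (A ltac:(lra)).
    assert (0 < 1 / 200 / x) by (apply Rdiv_lt_0_compat; lra).
    unfold Rdiv in *. lra.
Qed.

(* With y := 1 - q - 8 K w > 0 one has w y' <= (3/2) y^2: once the slope q drops
   below 1 - 8 K w it approaches 1 no faster than 1 / |ln w|. *)
Lemma slow_branch (g P : R -> R) (K w0 w1 : R) :
  linear_at_0 K g -> connecting g 2 P -> 0 < w1 -> w1 <= w0 -> w0 < 1 ->
  (forall w, 0 < w <= w0 -> 9 / 10 <= slope P w) ->
  slope P w1 < 1 - 8 * K * w1 ->
  exists C, forall w, 0 < w <= w1 ->
    0 < C - 3 / 2 * ln w /\ slope P w <= 1 - / (C - 3 / 2 * ln w).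
Proof.
  intros Hg HP Hw1 Hw10 Hw0 Hlow Hq1. assert (HK := proj1 Hg).
  pose (Y := fun w => 1 - 8 * K * w - slope P w).
  pose (y := fun w => - (8 * K) - (2 - slope P w - (g w / w) / slope P w) / w).
  assert (DY : forall v, 0 < v <= w1 -> is_derive Y v (y v)).
  { intros v Hv. apply (is_derive_minus (fun v => 1 - 8 * K * v) (slope P)).
    - auto_derive; [trivial | ring].
    - apply (slope_equation g P 2 K v Hg (proj1 HP)). lra. }
  assert (Hy : forall v, 0 < v <= w1 -> 0 < Y v -> v * y v <= 3 / 2 * Y v ^ 2 /\ Y v <= 1 / 10).
  { intros v Hv HYv. unfold y, Y in *.
    destruct (slope_equation g P 2 K v Hg (proj1 HP)) as [Sp [Hr _]]; [lra|].
    specialize (Hlow v ltac:(lra)). apply Rabs_le_between in Hr.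
    replace (v * (- (8 * K) - (2 - slope P v - g v / v / slope P v) / v))
      with (- 8 * (K * v) - (2 - slope P v - g v / v / slope P v)) by (field; lra).
    set (q := slope P v) in *. set (r := g v / v) in *.
    replace (8 * K * v) with (8 * (K * v)) in * by ring.
    assert (Hk0 : 0 < K * v) by nra. set (k := K * v) in *.
    split; [| lra].
    (* With [r <= 1 + k], multiplication by [q = 1 - 8 k - z] leaves [7 k + z^2 / 2] to absorb the
       remaining terms, which are small because [8 k + z <= 1/10]. *)
    assert (r / q <= 2 - q + 8 * k + 3 / 2 * (1 - 8 * k - q) ^ 2); [| lra].
    apply Rle_div_l; [trivial|].
    set (z := 1 - 8 * k - q) in *.
    replace q with (1 - 8 * k - z) by (unfold z; ring).
    assert (8 * k + z <= 1 / 10) by (unfold z; lra).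
    apply Rle_trans with (1 + k); [lra|].
    assert (0 <= z ^ 2) by apply pow2_ge_0.
    assert (0 <= k * (1 / 10 - 8 * k - z)) by (apply Rmult_le_pos; lra).
    assert (0 <= z ^ 2 * (1 / 10 - 8 * k - z)) by (apply Rmult_le_pos; lra).
    nra. }
  (* While [0 < Y <= 1/10], [w Y' <= 3/2 Y^2 <= Y], so [Y / w] does not decrease towards 0 and [Y]
     cannot reach zero. *)
  assert (Hpos : forall v, 0 < v <= w1 -> 0 < Y v).
  { intros v Hv.
    assert (H1 : 0 < Y w1 / w1) by (apply Rdiv_lt_0_compat; unfold Y; lra).
    assert (A : Y w1 / w1 <= Y v / v).
    { apply (positive_part_nonincreasing (fun w => Y w / w)
               (fun w => (w * y w - Y w) / w ^ 2)); try lra.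
      - intros x Hx. assert (D := DY x ltac:(lra)).
        assert (ex_derive Y x) by (eexists; apply D).
        auto_derive; [split; [trivial | split; [lra | trivial]]|].
        rewrite (is_derive_unique (fun x : R => Y x) _ _ D). field. lra.
      - intros x Hx Hp.
        assert (HYx : 0 < Y x).
        { apply (Rmult_lt_compat_r x) in Hp; [|lra].
          replace (Y x / x * x) with (Y x) in Hp by (field; lra). lra. }
        destruct (Hy x ltac:(lra) HYx) as [A B].
        apply Rle_div_l; [nra|]. nra. }
    apply (Rmult_le_compat_r v) in A; [|lra].
    replace (Y v / v * v) with (Y v) in A by (field; lra). nra. }
  (* The integrated form of [w Y' <= 3/2 Y^2]: the function [1 / Y + 3/2 ln w] is nondecreasing, and
     [C] is its value at [w1]. *)
  pose (C := / Y w1 + 3 / 2 * ln w1). exists C. intros w Hw.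
  assert (HYw := Hpos w Hw).
  assert (A : / Y w + 3 / 2 * ln w <= C).
  { apply (nondecreasing_of_derive (fun w => / Y w + 3 / 2 * ln w)
             (fun w => - y w / (Y w) ^ 2 + 3 / 2 * / w)); try lra.
    - intros x Hx. assert (HYx := Hpos x ltac:(lra)).
      apply (is_derive_plus (fun x => / Y x) (fun x => 3 / 2 * ln x)).
      + apply is_derive_inv; [apply DY; lra | lra].
      + apply is_derive_scal, is_derive_ln. lra.
    - intros x Hx. assert (HYx := Hpos x ltac:(lra)).
      destruct (Hy x ltac:(lra) HYx) as [B _].
      assert (E : y x / Y x ^ 2 <= 3 / 2 * / x).
      { apply Rle_div_l; [nra|].
        replace (3 / 2 * / x * Y x ^ 2) with (3 / 2 * Y x ^ 2 / x) by (field; lra).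
        apply Rle_div_r; lra. }
      unfold Rdiv in *. lra. }
  assert (HinvY : 0 < / Y w) by (apply Rinv_0_lt_compat; trivial).
  split; [lra|].
  assert (B : / (C - 3 / 2 * ln w) <= Y w).
  { rewrite <- (Rinv_inv (Y w)). apply Rinv_le_contravar; lra. }
  unfold Y in B. nra.
Qed.

Lemma slope_dichotomy (g P : R -> R) (K : R) :
  linear_at_0 K g -> connecting g 2 P ->
  exists w0, 0 < w0 < 1 /\
    ((forall w, 0 < w <= w0 -> 9 / 10 <= slope P w /\ 1 - 8 * K * w <= slope P w) \/
     (exists C, forall w, 0 < w <= w0 ->
        0 < C - 3 / 2 * ln w /\ slope P w <= 1 - / (C - 3 / 2 * ln w))).
Proof.
  intros Hg HP. destruct (slope_lower_eventually g P K Hg HP) as [w0 [Hw0 Hlow]].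
  destruct (classic (exists w1, 0 < w1 <= w0 /\ slope P w1 < 1 - 8 * K * w1))
    as [[w1 [Hw1 H1]] | Hn].
  - exists w1. split; [lra|]. right.
    apply (slow_branch g P K w0 w1); trivial; lra.
  - exists w0. split; trivial. left. intros w Hw. split; [apply Hlow; trivial|].
    apply Rnot_lt_le; intros H. apply Hn. exists w. split; trivial.
Qed.

(** * Pure exponential decay *)

(** Here [d] is controlled only at the zeros of [D]. Read backwards from [b], [first_zero] gives the
    last zero before a negative stretch; a positive derivative there contradicts the sign just to
    its right. *)
Lemma nonnegative_of_upward_crossing (D d : R -> R) (a b : R) :
  a <= b -> (forall x, a <= x <= b -> is_derive D x (d x)) ->
  (forall x, a <= x <= b -> D x = 0 -> 0 < d x) -> 0 <= D a -> 0 <= D b.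
Proof.
  intros Hab HD Hd Ha. apply Rnot_lt_le; intros Hb.
  destruct (first_zero (fun t => - D (- t)) (- b) (- a)) as [z [Hz [Ez Hneg]]].
  - lra.
  - intros x Hx. apply (ex_derive_continuous (fun t => - D (- t))).
    eexists. apply (is_derive_opp (fun t => D (- t))), is_derive_reflect, HD. lra.
  - rewrite Ropp_involutive. lra.
  - rewrite Ropp_involutive. lra.
  - assert (E0 : D (- z) = 0) by lra.
    assert (Hl := Hd (- z) ltac:(lra) E0).
    assert (HDz := HD (- z) ltac:(lra)).
    apply is_derive_Reals in HDz. destruct (HDz (d (- z)) Hl) as [r Hr].
    pose (h := Rmin (r / 2) (z + b)).
    assert (Hrp := cond_pos r).
    assert (A := Rmin_l (r / 2) (z + b)). assert (B := Rmin_r (r / 2) (z + b)).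
    assert (Hh : 0 < h) by (apply Rmin_glb_lt; lra). fold h in A, B.
    specialize (Hr h ltac:(lra) ltac:(rewrite Rabs_right; lra)).
    rewrite E0, Rminus_0_r in Hr. apply Rabs_def2 in Hr.
    specialize (Hneg (z - h) ltac:(lra)).
    replace (- (z - h)) with (- z + h) in Hneg by ring.
    assert (Hq : 0 < D (- z + h) / h) by lra.
    apply (Rmult_lt_compat_r h) in Hq; [|lra].
    replace (D (- z + h) / h * h) with (D (- z + h)) in Hq by (field; lra). lra.
Qed.

(** Near [q = 1], [w q'] is close to [c - 2 > 0]. So [q] crosses each level of a band around 1 only
    upwards in [w], and by the logarithmic argument it cannot stay in the band down to 0. *)
Lemma slope_away_from_1 (g P : R -> R) (c K : R) :
  linear_at_0 K g -> connecting g c P -> 2 < c ->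
  exists w0 e, 0 < w0 < 1 /\ 0 < e < 1 /\
    ((forall w, 0 < w <= w0 -> 1 + e <= slope P w) \/
     (forall w, 0 < w <= w0 -> slope P w <= 1 - e)).
Proof.
  intros Hg HP Hc. assert (HK := proj1 Hg).
  pose (e := Rmin (/ 4) ((c - 2) / 8)).
  assert (He : 0 < e /\ e <= / 4 /\ e <= (c - 2) / 8).
  { unfold e. split; [apply Rmin_glb_lt; lra | split; [apply Rmin_l | apply Rmin_r]]. }
  destruct (small_multiple K ((c - 2) / 8)) as [w0 [Hw0 Hs]]; [lra | lra |].
  pose (y := fun w => (c - slope P w - (g w / w) / slope P w) / w).
  assert (Hy : forall w, 0 < w <= w0 -> is_derive (slope P) w (y w) /\
            (1 - e <= slope P w <= 1 + e -> (c - 2) / 4 / w <= y w)).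
  { intros w Hw.
    destruct (slope_equation g P c K w Hg (proj1 HP)) as [Sp [Hr D]]; [lra|].
    split; trivial. intros Hq.
    apply Rmult_le_compat_r; [left; apply Rinv_0_lt_compat; lra|].
    apply Rabs_le_between in Hr. assert (K * w <= (c - 2) / 8) by nra.
    set (q := slope P w) in *. set (r := g w / w) in *.
    assert (r / q <= c - q - (c - 2) / 4); [| lra].
    apply Rle_div_l; [trivial|].
    (* From [(q - 1)^2 <= e^2], with one factor [e <= 1/4] and the other [e <= (c - 2) / 8]. *)
    assert ((q - 1) ^ 2 <= (c - 2) / 32) by nra. nra. }
  assert (Hlevel : forall l a b, 1 - e <= l <= 1 + e -> 0 < a -> a <= b -> b <= w0 ->
            l <= slope P a -> l <= slope P b).
  { intros l a b Hl Ha Hab Hb H.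
    assert (0 <= slope P b - l); [| lra].
    apply (nonnegative_of_upward_crossing (fun w => slope P w - l) (fun w => y w - 0) a b);
      try lra.
    - intros x Hx. apply (is_derive_minus (slope P) (fun _ => l)).
      + apply Hy. lra.
      + exact (is_derive_const l x).
    - intros x Hx Ex. destruct (Hy x) as [_ A]; [lra|]. specialize (A ltac:(lra)).
      assert (0 < (c - 2) / 4 / x) by (apply Rdiv_lt_0_compat; lra). lra. }
  destruct (classic (exists w1, 0 < w1 <= w0 /\ slope P w1 < 1 + e)) as [[w1 [Hw1 H1]] | Hn].
  - assert (Hex : exists w2, 0 < w2 <= w1 /\ slope P w2 < 1 - e).
    { apply NNPP; intros Hn.
      apply (no_logarithmic_growth (fun w => - slope P w) (fun w => - y w) w1 ((c - 2) / 4) 0);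
        try lra.
      - intros w Hw. split; [apply (is_derive_opp (slope P)), Hy; lra|].
        assert (slope P w < 1 + e).
        { apply Rnot_le_lt; intros H. specialize (Hlevel (1 + e) w w1). lra. }
        assert (1 - e <= slope P w).
        { apply Rnot_lt_le; intros H'. apply Hn. exists w. split; trivial. }
        destruct (Hy w) as [_ A]; [lra|]. specialize (A ltac:(lra)). unfold Rdiv in *. lra.
      - intros w Hw.
        destruct (slope_equation g P c K w Hg (proj1 HP)) as [Sp _]; [lra|]. lra. }
    destruct Hex as [w2 [Hw2 H2]]. exists w2, e. split; [lra | split; [lra|]]. right.
    intros w Hw. apply Rnot_lt_le; intros H. specialize (Hlevel (1 - e) w w2). lra.
  - exists w0, e. split; [lra | split; [lra|]]. left. intros w Hw.
    apply Rnot_lt_le; intros H. apply Hn. exists w. split; trivial.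
Qed.

(** At [x = X w] the phase [X w + ln w] is [ln (W x / e^(-x))]: pure decay means that it has a
    finite limit, [ln B], as [w] tends to 0. *)
Lemma is_derive_phase (g P X : R -> R) (c w : R) :
  profile g c P -> 0 < w < 1 -> is_derive X w (- / P w) ->
  is_derive (fun w => X w + ln w) w ((1 - / slope P w) / w).
Proof.
  intros [HP _] Hw HX. destruct (HP w Hw) as [Pp _].
  replace ((1 - / slope P w) / w) with (- / P w + / w).
  - apply (is_derive_plus X ln); [trivial | apply is_derive_ln; lra].
  - unfold slope. field. lra.
Qed.

Lemma wave_inverse_decreasing (g W P X : R -> R) (c a b : R) :
  profile g c P -> wave_inverse W P X -> 0 < a -> a < b -> b < 1 -> X b < X a.
Proof.
  intros [HP _] [HX _] Ha Hab Hb.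
  apply (decreasing_of_derive X (fun w => - / P w)); trivial.
  - intros x Hx. apply HX. lra.
  - intros x Hx. assert (0 < / P x); [| lra]. apply Rinv_0_lt_compat, HP. lra.
Qed.

Lemma phase_bounded (g W P X : R -> R) (c : R) :
  profile g c P -> wave_inverse W P X -> pure_exponential_decay W ->
  exists w0 M, 0 < w0 < 1 /\ forall w, 0 < w <= w0 -> Rabs (X w + ln w) <= M.
Proof.
  intros HP HX [B [HB HW]].
  assert (HB2 : 0 < B / 2) by lra.
  (* With the constant [B / 2], the o-term traps [W] between [B/2 e^(-x)] and [3B/2 e^(-x)]. *)
  destruct (HW (mkposreal _ HB2)) as [x0 Hx0].
  pose (w0 := W (x0 + 1)).
  assert (Hw0 : 0 < w0 < 1) by apply HX.
  exists w0, (Rmax (ln (3 * B / 2)) (- ln (B / 2))). split; trivial. intros w Hw.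
  assert (Hx : x0 < X w).
  { assert (X w0 <= X w).
    { destruct (proj2 Hw) as [H| ->]; [left | lra].
      apply (wave_inverse_decreasing g W P X c); trivial; lra. }
    unfold w0 in H. rewrite (proj2 (proj2 HX (x0 + 1))) in H. lra. }
  specialize (Hx0 _ Hx). simpl in Hx0.
  change (Rabs (W (X w) - B * exp (- X w)) <= B / 2 * Rabs (exp (- X w))) in Hx0.
  rewrite (proj2 (proj1 HX w ltac:(lra))) in Hx0.
  assert (He := exp_pos (- X w)).
  rewrite (Rabs_right (exp (- X w))) in Hx0 by lra. apply Rabs_le_between in Hx0.
  assert (L1 : ln w <= ln (3 * B / 2) - X w).
  { replace (ln (3 * B / 2) - X w) with (ln (3 * B / 2 * exp (- X w)))
      by (rewrite ln_mult, ln_exp; lra).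
    apply ln_le; lra. }
  assert (L2 : ln (B / 2) - X w <= ln w).
  { replace (ln (B / 2) - X w) with (ln (B / 2 * exp (- X w)))
      by (rewrite ln_mult, ln_exp; lra).
    apply ln_le; nra. }
  assert (M1 := Rmax_l (ln (3 * B / 2)) (- ln (B / 2))).
  assert (M2 := Rmax_r (ln (3 * B / 2)) (- ln (B / 2))).
  apply Rabs_le_between. lra.
Qed.

(** A slope bounded away from 1 gives the phase a derivative of constant sign and of size at least
    [const / w], so the phase is unbounded. *)
Lemma pushed_wave_not_pure (g W P X : R -> R) (c K : R) :
  linear_at_0 K g -> connecting g c P -> wave_inverse W P X -> 2 < c ->
  ~ pure_exponential_decay W.
Proof.
  intros Hg HP HX Hc Hpure.
  destruct (phase_bounded g W P X c (proj1 HP) HX Hpure) as [w1 [M [Hw1 HM]]].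
  destruct (slope_away_from_1 g P c K Hg HP Hc) as [w2 [e [Hw2 [He Hs]]]].
  pose (w0 := Rmin w1 w2).
  assert (Hw0 : 0 < w0 /\ w0 <= w1 /\ w0 <= w2).
  { unfold w0. split; [apply Rmin_glb_lt; lra | split; [apply Rmin_l | apply Rmin_r]]. }
  assert (D := fun w (H : 0 < w < 1) =>
    is_derive_phase g P X c w (proj1 HP) H (proj1 (proj1 HX w H))).
  destruct Hs as [Hs|Hs].
  - apply (no_logarithmic_growth (fun w => - (X w + ln w)) (fun w => - ((1 - / slope P w) / w))
             w0 (e / (1 + e)) M); try lra.
    + apply Rdiv_lt_0_compat; lra.
    + intros w Hw. split; [apply (is_derive_opp (fun w => X w + ln w)), D; lra|].
      specialize (Hs w ltac:(lra)).
      assert (A : / slope P w <= / (1 + e)) by (apply Rinv_le_contravar; lra).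
      replace (e / (1 + e)) with (1 - / (1 + e)) by (field; lra).
      assert (B : 0 < / w) by (apply Rinv_0_lt_compat; lra).
      unfold Rdiv. nra.
    + intros w Hw. specialize (HM w ltac:(lra)). apply Rabs_le_between in HM. lra.
  - apply (no_logarithmic_growth (fun w => X w + ln w) (fun w => (1 - / slope P w) / w)
             w0 (e / (1 - e)) M); try lra.
    + apply Rdiv_lt_0_compat; lra.
    + intros w Hw. split; [apply D; lra|].
      specialize (Hs w ltac:(lra)).
      destruct (slope_equation g P c K w Hg (proj1 HP)) as [Sp _]; [lra|].
      assert (A : / (1 - e) <= / slope P w) by (apply Rinv_le_contravar; lra).
      replace (e / (1 - e)) with (/ (1 - e) - 1) by (field; lra).
      assert (B : 0 < / w) by (apply Rinv_0_lt_compat; lra).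
      unfold Rdiv. nra.
    + intros w Hw. specialize (HM w ltac:(lra)). apply Rabs_le_between in HM. lra.
Qed.

Lemma slope_lower_of_pure (g W P X : R -> R) (K : R) :
  linear_at_0 K g -> connecting g 2 P -> wave_inverse W P X -> pure_exponential_decay W ->
  exists w0, 0 < w0 < 1 /\
    forall w, 0 < w <= w0 -> 9 / 10 <= slope P w /\ 1 - 8 * K * w <= slope P w.
Proof.
  intros Hg HP HX Hpure.
  destruct (slope_dichotomy g P K Hg HP) as [w1 [Hw1 [H|[C HC]]]].
  - exists w1. split; trivial.
  - exfalso.
    destruct (phase_bounded g W P X 2 (proj1 HP) HX Hpure) as [w2 [M [Hw2 HM]]].
    pose (w0 := Rmin w1 w2).
    assert (Hw0 : 0 < w0 /\ w0 <= w1 /\ w0 <= w2).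
    { unfold w0. split; [apply Rmin_glb_lt; lra | split; [apply Rmin_l | apply Rmin_r]]. }
    (* On the slow branch [1/q >= 1 + 1 / (C - 3/2 ln w)]. The subtracted term is the integral of
       the resulting bound on the phase derivative; it tends to infinity at 0, so the phase does
       too. *)
    pose (U := fun w => X w + ln w - 2 / 3 * ln (C - 3 / 2 * ln w)).
    assert (HU : forall w, 0 < w <= w0 -> U w0 <= U w).
    { intros w Hw.
      apply (nonincreasing_of_derive U
        (fun w => (1 - / slope P w) / w - 2 / 3 * (- (3 / 2) / w / (C - 3 / 2 * ln w)))); try lra.
      - intros x Hx. destruct (HC x) as [Cp _]; [lra|].
        apply (is_derive_minus (fun x => X x + ln x) (fun x => 2 / 3 * ln (C - 3 / 2 * ln x))).
        + apply (is_derive_phase g P X 2 x (proj1 HP)); [lra|]. apply HX. lra.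
        + apply is_derive_scal. auto_derive; [split; [lra | split; [lra | trivial]]|].
          field. split; lra.
      - intros x Hx. destruct (HC x) as [Cp Cq]; [lra|].
        destruct (slope_equation g P 2 K x Hg (proj1 HP)) as [Sp _]; [lra|].
        assert (Ci : 0 < / (C - 3 / 2 * ln x)) by (apply Rinv_0_lt_compat; trivial).
        replace ((1 - / slope P x) / x - 2 / 3 * (- (3 / 2) / x / (C - 3 / 2 * ln x)))
          with ((1 - / slope P x + / (C - 3 / 2 * ln x)) / x) by (field; lra).
        set (i := / (C - 3 / 2 * ln x)) in *. set (q := slope P x) in *.
        assert (Hq : 1 + i <= / q).
        { replace (/ q) with (1 / q) by (field; lra). apply Rle_div_r; [trivial|]. nra. }
        assert (0 < / x) by (apply Rinv_0_lt_compat; lra). unfold Rdiv. nra. }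
    pose (N := exp (3 / 2 * (M - U w0))).
    destruct (ln_unbounded_below (2 / 3 * (C - N))) as [w3 [Hw3 Hl]].
    pose (w := Rmin w0 w3).
    assert (Hw : 0 < w /\ w <= w0 /\ w <= w3).
    { unfold w. split; [apply Rmin_glb_lt; lra | split; [apply Rmin_l | apply Rmin_r]]. }
    specialize (Hl w ltac:(lra)). specialize (HU w ltac:(lra)).
    specialize (HM w ltac:(lra)). apply Rabs_le_between in HM.
    destruct (HC w) as [Cp _]; [lra|].
    assert (A : ln N < ln (C - 3 / 2 * ln w)).
    { apply ln_increasing; [apply exp_pos | lra]. }
    unfold N in A. rewrite ln_exp in A. change (U w) with (X w + ln w - 2 / 3 * ln (C - 3 / 2 * ln w)) in HU.
    lra.
Qed.

Lemma pure_of_slope_bounds (g W P X : R -> R) (K w0 : R) :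
  linear_at_0 K g -> connecting g 2 P -> wave_inverse W P X -> 0 < w0 < 1 ->
  (forall w, 0 < w <= w0 -> 9 / 10 <= slope P w /\ 1 - 8 * K * w <= slope P w) ->
  pure_exponential_decay W.
Proof.
  intros Hg HP HX Hw0 Hs. assert (HK := proj1 Hg).
  (* The phase is Lipschitz up to 0: [|q - 1| <= 8 K w] and [q >= 9/10] give
     [|1 - 1/q| / w <= 80 K / 9 <= 10 K]. *)
  pose (S := fun w => X w + ln w). pose (L := 10 * K).
  assert (HL : forall v w, 0 < v -> v <= w -> w <= w0 -> Rabs (S w - S v) <= L * (w - v)).
  { intros v w Hv Hvw Hw.
    apply (variation_bound S (fun w => (1 - / slope P w) / w)); trivial.
    - intros x Hx. apply (is_derive_phase g P X 2 x (proj1 HP)); [lra|]. apply HX. lra.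
    - intros x Hx. destruct (Hs x) as [A B]; [lra|].
      assert (C := slope_upper g P K x Hg HP ltac:(lra)).
      set (q := slope P x) in *.
      replace ((1 - / q) / x) with ((q - 1) / (q * x)) by (field; lra).
      unfold L. apply Rabs_le_between. split.
      + apply Rle_div_r; nra.
      + apply Rle_div_l; nra. }
  (* [S w - L w] is nonincreasing in [w], so its supremum is its limit at 0, which is also the limit
     of the phase [S]. *)
  destruct (completeness (fun z => exists w, 0 < w <= w0 /\ z = S w - L * w)) as [l [Hl1 Hl2]].
  { exists (S w0 + L * w0). intros z [w [Hw ->]].
    specialize (HL w w0 (proj1 Hw) (proj2 Hw) (Rle_refl _)). apply Rabs_le_between in HL.
    unfold L in *. nra. }
  { exists (S w0 - L * w0). exists w0. split; [lra | reflexivity]. }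
  assert (Hlim : forall w, 0 < w <= w0 -> Rabs (S w - l) <= L * w).
  { intros w Hw. apply Rabs_le_between. split.
    - assert (l <= S w + L * w); [| lra].
      apply Hl2. intros z [v [Hv ->]].
      destruct (Rle_lt_dec v w) as [H|H].
      + specialize (HL v w (proj1 Hv) H (proj2 Hw)). apply Rabs_le_between in HL.
        unfold L in *. nra.
      + specialize (HL w v (proj1 Hw) (Rlt_le _ _ H) (proj2 Hv)). apply Rabs_le_between in HL.
        unfold L in *. nra.
    - assert (S w - L * w <= l); [| lra].
      apply Hl1. exists w. split; trivial. }
  exists (exp l). split; [apply exp_pos|].
  intros e.
  assert (Cexp : continuity_pt exp l) by apply derivable_continuous_pt, derivable_pt_exp.
  destruct (Cexp e (cond_pos e)) as [d [Hd He]].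
  destruct (small_multiple L (d / 2)) as [w1 [Hw1 Hs1]]; [unfold L; lra | lra |].
  pose (w2 := Rmin w0 w1).
  assert (Hw2 : 0 < w2 /\ w2 <= w0 /\ w2 <= w1).
  { unfold w2. split; [apply Rmin_glb_lt; lra | split; [apply Rmin_l | apply Rmin_r]]. }
  exists (X w2). intros x Hx.
  destruct (proj2 HX x) as [Wr XW].
  assert (Wx : W x < w2).
  { apply Rnot_le_lt; intros [H|H].
    - assert (A := wave_inverse_decreasing g W P X 2 w2 (W x) (proj1 HP) HX). lra.
    - rewrite <- H in XW. lra. }
  change (Rabs (W x - exp l * exp (- x)) <= e * Rabs (exp (- x))).
  assert (Ep := exp_pos (- x)).
  assert (EW : W x = exp (S (W x)) * exp (- x)).
  { rewrite <- exp_plus. unfold S. rewrite XW.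
    replace (x + ln (W x) + - x) with (ln (W x)) by ring.
    symmetry. apply exp_ln. lra. }
  rewrite EW.
  replace (exp (S (W x)) * exp (- x) - exp l * exp (- x))
    with ((exp (S (W x)) - exp l) * exp (- x)) by ring.
  rewrite Rabs_mult. apply Rmult_le_compat_r; [apply Rabs_pos|].
  specialize (Hlim (W x) ltac:(lra)).
  destruct (Req_dec (S (W x)) l) as [-> | Hne].
  - rewrite Rminus_diag, Rabs_R0. left. apply cond_pos.
  - left. apply He. split; [split; [exact I | auto]|].
    change (Rabs (S (W x) - l) < d). unfold L in *. nra.
Qed.

(* The slope of a purely exponential profile is 1 - (g''(0)/2) w + o(w), so a
   larger second derivative at 0 forces a smaller slope, whereas g <= g' forces
   P <= P'. *)
Lemma no_profile_above_pure (g g' P P' : R -> R) (K w0 e : R) :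
  linear_at_0 K g -> linear_at_0 K g' -> connecting g 2 P -> connecting g' 2 P' ->
  (forall w, 0 < w < 1 -> g w <= g' w) ->
  0 < w0 < 1 -> 0 < e -> (forall w, 0 < w <= w0 -> e * w ^ 2 <= g' w - g w) ->
  (forall w, 0 < w <= w0 -> 9 / 10 <= slope P w /\ 1 - 8 * K * w <= slope P w) -> False.
Proof.
  intros Hg Hg' HP HP' Hle Hw0 He Hgap Hlow. assert (HK := proj1 Hg).
  assert (HPP : forall w, 0 < w < 1 -> slope P w <= slope P' w).
  { intros w Hw. apply Rmult_le_compat_r; [left; apply Rinv_0_lt_compat; lra|].
    apply (profile_le_supersolution g P P' 2); trivial.
    - intros v Hv. apply Hg; trivial.
    - apply HP.
    - intros b Hb v Hv. destruct (proj1 (proj1 HP') v) as [Pp D]; [lra|].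
      split; trivial. exists (2 - g' v / P' v). split; trivial.
      assert (g v / P' v <= g' v / P' v); [| lra].
      apply Rmult_le_compat_r; [left; apply Rinv_0_lt_compat; trivial | apply Hle; lra]. }
  destruct (small_multiple K (1 / 100)) as [wa [Hwa Hsa]]; [lra | lra |].
  (* 189 = 9 * 21: below, [q' - q <= 9 K w] and [r / (q q') - 1 <= 21 K w]. *)
  destruct (small_multiple (189 * K ^ 2) (e / 4)) as [wb [Hwb Hsb]]; [nra | lra |].
  pose (w1 := Rmin w0 (Rmin wa wb)).
  assert (Hw1 : 0 < w1 /\ w1 <= w0 /\ w1 <= wa /\ w1 <= wb).
  { unfold w1. repeat split.
    - repeat apply Rmin_glb_lt; lra.
    - apply Rmin_l.
    - eapply Rle_trans; [apply Rmin_r | apply Rmin_l].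
    - eapply Rle_trans; [apply Rmin_r | apply Rmin_r]. }
  (* The contradiction: [E >= 0] everywhere and [E] tends to 0 at 0, both slopes being [1 + O(w)],
     whereas [E' <= - e / 4] near 0. *)
  pose (E := fun w => slope P' w - slope P w).
  pose (y := fun w => (2 - slope P' w - (g' w / w) / slope P' w) / w -
                      (2 - slope P w - (g w / w) / slope P w) / w).
  assert (HE : forall w, 0 < w <= w1 -> is_derive E w (y w) /\ y w <= - (e / 4)).
  { intros w Hw.
    destruct (slope_equation g P 2 K w Hg (proj1 HP)) as [Sp [Hr D]]; [lra|].
    destruct (slope_equation g' P' 2 K w Hg' (proj1 HP')) as [Sp' [Hr' D']]; [lra|].
    split; [apply (is_derive_minus (slope P') (slope P)); trivial|].
    unfold y. specialize (HPP w ltac:(lra)). destruct (Hlow w) as [L1 L2]; [lra|].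
    assert (U := slope_upper g' P' K w Hg' HP' ltac:(lra)).
    assert (Hd : e * w <= g' w / w - g w / w).
    { specialize (Hgap w ltac:(lra)).
      replace (g' w / w - g w / w) with ((g' w - g w) / w) by (field; lra).
      apply (proj1 (Rle_div_r (e * w) (g' w - g w) w ltac:(lra))). lra. }
    set (q := slope P w) in *. set (q' := slope P' w) in *.
    set (r := g w / w) in *. set (r' := g' w / w) in *.
    apply Rabs_le_between in Hr. apply Rabs_le_between in Hr'.
    assert (Hk0 : 0 < K * w) by nra. assert (Hk : K * w <= 1 / 100) by nra.
    assert (Hk2 : 189 * (K * w) ^ 2 <= e / 4 * w) by nra.
    replace (8 * K * w) with (8 * (K * w)) in * by ring.
    set (k := K * w) in *.
    (* This separates the effect of the differing slopes, of order [w^2], from that of the differing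
       nonlinearities, at least [e w / 2] in size. *)
    replace ((2 - q' - r' / q') / w - (2 - q - r / q) / w)
      with (((q' - q) * (r / (q * q') - 1) - (r' - r) / q') / w) by (field; lra).
    apply Rle_div_l; [lra|].
    assert (A1 : r / (q * q') - 1 <= 21 * k).
    { assert (r / (q * q') <= 1 + 21 * k); [| lra].
      assert (Hqq : 1 - 16 * k <= q * q').
      { assert ((1 - 8 * k) * (1 - 8 * k) <= q * q') by (apply Rmult_le_compat; lra). nra. }
      apply Rle_div_l; [nra|].
      assert ((1 + 21 * k) * (1 - 16 * k) <= (1 + 21 * k) * (q * q'))
        by (apply Rmult_le_compat_l; lra).
      nra. }
    assert (A2 : (q' - q) * (r / (q * q') - 1) <= 189 * k ^ 2).
    { apply Rle_trans with ((q' - q) * (21 * k)).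
      - apply Rmult_le_compat_l; lra.
      - nra. }
    assert (A3 : e * w / 2 <= (r' - r) / q').
    { apply (proj1 (Rle_div_r (e * w / 2) (r' - r) q' Sp')).
      assert (0 < e * w) by nra. nra. }
    lra. }
  pose (v := Rmin (w1 / 2) (e * w1 / (16 * (9 * K + e)))).
  assert (Hv0 : 0 < e * w1 / (16 * (9 * K + e))).
  { apply Rdiv_lt_0_compat; [nra | lra]. }
  assert (Hv : 0 < v /\ v <= w1 / 2 /\ v <= e * w1 / (16 * (9 * K + e))).
  { unfold v. split; [apply Rmin_glb_lt; lra | split; [apply Rmin_l | apply Rmin_r]]. }
  assert (A : E w1 + e / 4 * w1 <= E v + e / 4 * v).
  { apply (nonincreasing_of_derive (fun w => E w + e / 4 * w) (fun w => y w + e / 4)); try lra.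
    - intros x Hx. apply (is_derive_plus E (fun x => e / 4 * x)); [apply HE; lra|].
      auto_derive; [trivial | ring].
    - intros x Hx. destruct (HE x) as [_ B]; lra. }
  assert (B : 0 <= E w1) by (unfold E; specialize (HPP w1); lra).
  assert (C : E v <= 9 * K * v).
  { unfold E. destruct (Hlow v) as [_ L2]; [lra|].
    assert (U := slope_upper g' P' K v Hg' HP' ltac:(lra)). lra. }
  assert (D : v * (16 * (9 * K + e)) <= e * w1).
  { destruct Hv as [_ [_ Hv]].
    apply (Rmult_le_compat_r (16 * (9 * K + e))) in Hv; [|lra].
    replace (e * w1 / (16 * (9 * K + e)) * (16 * (9 * K + e))) with (e * w1) in Hv
      by (field; lra).
    trivial. }
  assert (0 < K * v) by nra. assert (0 < e * v) by nra. assert (0 < e * w1) by nra. lra.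
Qed.

(* The constant comes from e^t >= (t/3)^3, i.e. w |ln w|^3 <= 27. *)
Lemma logarithmic_supersolution (K : R) :
  0 < K -> exists w0, 0 < w0 < 1 /\ forall g a b, linear_at_0 K g -> 0 < a -> b <= w0 ->
    supersolution g 2 a b (fun w => w + w / (2 * ln w)).
Proof.
  intros HK.
  assert (He1 : exp (- (216 * K + 2)) < 1).
  { apply Rlt_le_trans with (exp 0); [apply exp_increasing; lra | rewrite exp_0; lra]. }
  (* With [t = - ln w] and [216 = 8 * 27]: [t >= 216 K] and [w t^3 <= 27] yield [8 K w t^2 <= 1];
     the summand 2 ensures [1/t <= 1/2]. *)
  exists (exp (- (216 * K + 2))). split; [split; [apply exp_pos | trivial] |].
  intros g a b Hg Ha Hb w Hw.
  assert (Hw1 : w < 1) by lra.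
  pose (t := - ln w).
  assert (Ht : 216 * K + 2 <= t).
  { unfold t. assert (ln w <= - (216 * K + 2)); [| lra].
    rewrite <- (ln_exp (- (216 * K + 2))). apply ln_le; lra. }
  assert (Hcube : w * t ^ 3 <= 27).
  { assert (A : 1 + t / 3 <= exp (t / 3)) by apply exp_ineq1_le.
    assert (B : exp (t / 3) ^ 3 = / w).
    { simpl. rewrite Rmult_1_r, <- !exp_plus.
      replace (t / 3 + (t / 3 + t / 3)) with (- ln w) by (unfold t; field).
      rewrite exp_Ropp, exp_ln by lra. trivial. }
    assert (C : (t / 3) ^ 3 <= / w) by (rewrite <- B; apply pow_incr; lra).
    apply (Rmult_le_compat_l w) in C; [|lra]. rewrite Rinv_r in C by lra.
    replace (w * (t / 3) ^ 3) with (w * t ^ 3 / 27) in C by field. lra. }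
  assert (Hsq : 8 * K * w * t ^ 2 <= 1).
  { assert (0 < w * t ^ 2) by (apply Rmult_lt_0_compat; [lra | apply pow_lt; lra]).
    assert ((w * t ^ 2) * (216 * K) <= 27); [| lra].
    apply Rle_trans with (w * t ^ 2 * t); [apply Rmult_le_compat_l; lra|].
    replace (w * t ^ 2 * t) with (w * t ^ 3) by ring. trivial. }
  assert (El : ln w = - t) by (unfold t; ring).
  assert (Zw : w + w / (2 * ln w) = w * (1 - / (2 * t))) by (rewrite El; field; lra).
  assert (Hi : 0 < / t <= / 2).
  { split; [apply Rinv_0_lt_compat | apply Rinv_le_contravar]; lra. }
  assert (Hit : / (2 * t) = / t / 2) by (field; lra).
  assert (Zp : 0 < w * (1 - / (2 * t))) by (apply Rmult_lt_0_compat; lra).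
  split; [rewrite Zw; trivial|].
  exists (1 - / (2 * t) - / (2 * t ^ 2)). split.
  - auto_derive; [repeat split; lra|]. rewrite El. field. lra.
  - rewrite Zw.
    destruct (proj2 Hg w ltac:(lra)) as [_ Hgw]. apply Rabs_le_between in Hgw.
    assert (g w / (w * (1 - / (2 * t))) <= 1 + / (2 * t) + / (2 * t ^ 2)); [| lra].
    apply Rle_div_l; [trivial|].
    set (i := / t) in *.
    assert (E1 : t * i = 1) by (unfold i; field; lra).
    replace (/ (2 * t)) with (i / 2) by (unfold i; field; lra).
    replace (/ (2 * t ^ 2)) with (i ^ 2 / 2) by (unfold i; field; lra).
    assert (Kw : 8 * K * w <= i ^ 2).
    { replace (8 * K * w) with (8 * K * w * t ^ 2 * i ^ 2).
      - assert (0 < i ^ 2) by (apply pow_lt; lra). nra.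
      - replace (8 * K * w * t ^ 2 * i ^ 2) with (8 * K * w * (t * i) ^ 2) by ring.
        rewrite E1. ring. }
    apply Rle_trans with (w * (1 + i ^ 2 / 8)); [nra|].
    replace ((1 + i / 2 + i ^ 2 / 2) * (w * (1 - i / 2)))
      with (w * ((1 + i / 2 + i ^ 2 / 2) * (1 - i / 2))) by ring.
    apply Rmult_le_compat_l; [lra|].
    assert (0 <= i ^ 2 * (1 / 2 - i)) by (apply Rmult_le_pos; [apply pow2_ge_0 | lra]).
    nra.
Qed.

(** * Families of nonlinearities *)

Lemma continuous_clamp_comp (g : R -> R) :
  (forall w, unit_interval w -> continue_in g unit_interval w) ->
  forall x, continuous (fun y => g (clamp y)) x.
Proof.
  intros Hg x. apply continuity_pt_filterlim. intros e He.
  destruct (Hg (clamp x) (clamp_range x) e He) as [d [Hd H]].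
  exists d. split; trivial. intros y [_ Hy]. simpl in *. unfold Rdist in *.
  destruct (Req_dec (clamp y) (clamp x)) as [-> | Hne].
  - rewrite Rminus_diag, Rabs_R0. trivial.
  - apply H. split.
    + split; [apply clamp_range | auto].
    + eapply Rle_lt_trans; [apply clamp_lipschitz | trivial].
Qed.

Lemma is_derive_of_D_in (g g1 : R -> R) (w : R) :
  0 < w < 1 -> D_in g g1 unit_interval w -> is_derive g w (g1 w).
Proof.
  intros Hw H. apply is_derive_Reals. intros e He.
  destruct (H e He) as [d [Hd Hlim]].
  pose (r := Rmin d (Rmin w (1 - w))).
  assert (Hr : 0 < r /\ r <= d /\ r <= w /\ r <= 1 - w).
  { unfold r. repeat split.
    - repeat apply Rmin_glb_lt; lra.
    - apply Rmin_l.
    - eapply Rle_trans; [apply Rmin_r | apply Rmin_l].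
    - eapply Rle_trans; [apply Rmin_r | apply Rmin_r]. }
  exists (mkposreal r (proj1 Hr)). simpl. intros h Hh Hhr.
  specialize (Hlim (w + h)). simpl in Hlim. unfold Rdist in Hlim.
  replace (w + h - w) with h in Hlim by ring. apply Hlim.
  apply Rabs_def2 in Hhr as Hhr'. split; [| lra].
  split; [unfold unit_interval; lra | lra].
Qed.

(** The derivatives are relative to [0,1]; composed with [clamp], [g] becomes continuous across the
    endpoints and the usual mean value theorem applies. *)
Lemma unit_MVT (g g1 : R -> R) (a b : R) :
  (forall w, unit_interval w -> D_in g g1 unit_interval w) ->
  0 <= a -> a <= b -> b <= 1 -> exists z, a <= z <= b /\ g b - g a = g1 z * (b - a).
Proof.
  intros Hg Ha Hab Hb.
  destruct (MVT_gen (fun x => g (clamp x)) a b g1) as [z [Hz E]].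
  - intros x Hx. rewrite Rmin_left, Rmax_right in Hx by lra.
    apply (is_derive_ext_loc g).
    + assert (Hr : 0 < Rmin x (1 - x)) by (apply Rmin_glb_lt; lra).
      exists (mkposreal _ Hr). intros y Hy.
      change (Rabs (y - x) < Rmin x (1 - x)) in Hy. apply Rabs_def2 in Hy.
      assert (A := Rmin_l x (1 - x)). assert (B := Rmin_r x (1 - x)).
      rewrite clamp_id; [trivial | lra].
    + apply is_derive_of_D_in; [lra|]. apply Hg. unfold unit_interval. lra.
  - intros x Hx. apply continuity_pt_filterlim.
    apply (continuous_clamp_comp g). intros w Hw. apply cont_deriv with g1, Hg; trivial.
  - rewrite Rmin_left, Rmax_right in Hz by lra.
    rewrite !clamp_id in E by lra. exists z. split; trivial.
Qed.

Lemma bounded_on_unit (g : R -> R) :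
  (forall w, unit_interval w -> continue_in g unit_interval w) ->
  exists M, 0 < M /\ forall w, unit_interval w -> Rabs (g w) <= M.
Proof.
  intros Hg.
  destruct (continuity_ab_maj (fun x => Rabs (g (clamp x))) 0 1) as [z [Hz _]]; [lra | |].
  - intros x _. apply continuity_pt_filterlim.
    apply (continuous_Rabs_comp (fun x => g (clamp x))), continuous_clamp_comp; trivial.
  - exists (Rabs (g (clamp z)) + 1).
    assert (A := Rabs_pos (g (clamp z))). split; [lra|].
    intros w Hw. specialize (Hz w Hw). simpl in Hz. rewrite (clamp_id w Hw) in Hz. lra.
Qed.

Lemma linear_at_0_intro (g g1 g2 : R -> R) (K : R) :
  C2_unit g g1 g2 -> g 0 = 0 -> g1 0 = 1 -> (forall w, 0 < w < 1 -> 0 < g w) ->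
  0 < K -> (forall w, unit_interval w -> Rabs (g2 w) <= K) -> linear_at_0 K g.
Proof.
  intros Hg g0 g10 Hpos HK Hb. split; trivial. intros w Hw.
  split; [left; apply Hpos; trivial|].
  destruct (unit_MVT g g1 0 w) as [z [Hz E]]; try lra; [apply Hg|].
  destruct (unit_MVT g1 g2 0 z) as [y [Hy E']]; try lra; [apply Hg|].
  rewrite g0, !Rminus_0_r in E. rewrite g10, Rminus_0_r in E'.
  replace (g w - w) with (g2 y * z * w) by (rewrite E; replace (g1 z) with (1 + g2 y * z) by lra; ring).
  assert (A : Rabs (g2 y) <= K) by (apply Hb; unfold unit_interval; lra).
  rewrite !Rabs_mult, (Rabs_right w), (Rabs_right z) by lra.
  assert (B := Rabs_pos (g2 y)).
  assert (Rabs (g2 y) * z <= K * w) by (apply Rmult_le_compat; lra). nra.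
Qed.

Lemma linear_at_0_weaken (g : R -> R) (K K' : R) :
  K <= K' -> linear_at_0 K g -> linear_at_0 K' g.
Proof.
  intros HKK [HK Hg]. split; [lra|]. intros w Hw. destruct (Hg w Hw) as [A B].
  split; trivial. assert (0 <= w ^ 2) by apply pow2_ge_0. nra.
Qed.

Lemma monostable_profile_exists (f f1 f2 : R -> R -> R) (s c : R) :
  monostable_family f f1 f2 -> 0 <= s -> 0 <= c -> exists P, profile (f s) c P.
Proof.
  intros HA1 Hs Hc. destruct (HA1 s Hs) as [HC [f0 [fone [_ [_ Hpos]]]]].
  assert (Hcont : forall w, unit_interval w -> continue_in (f s) unit_interval w).
  { intros w Hw. apply cont_deriv with (f1 s), HC; trivial. }
  destruct (bounded_on_unit (f s) Hcont) as [M [HM Hb]].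
  destruct (profile_exists (fun x => f s (clamp x)) c M) as [P [HP1 HP2]]; trivial.
  - apply continuous_clamp_comp; trivial.
  - intros x. assert (A := clamp_range x). specialize (Hb _ A). apply Rabs_le_between in Hb.
    split; [| lra].
    destruct (Rle_lt_or_eq_dec 0 (clamp x)) as [B|B]; [lra | | rewrite <- B; lra].
    destruct (Rle_lt_or_eq_dec (clamp x) 1) as [D|D]; [lra | | rewrite D; lra].
    left. apply Hpos. lra.
  - intros w Hw. rewrite clamp_id by lra. apply Hpos; trivial.
  - exists P. split; trivial. intros w Hw. specialize (HP1 w Hw).
    rewrite clamp_id in HP1 by lra. trivial.
Qed.

Lemma connecting_to_wave (f f1 f2 : R -> R -> R) (s c : R) (P : R -> R) :
  monostable_family f f1 f2 -> 0 <= s -> 0 < c -> connecting (f s) c P ->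
  exists W, travelling_wave (f s) c W.
Proof.
  intros HA1 Hs Hc HP. destruct (HA1 s Hs) as [HC [f0 [fone [_ [_ Hpos]]]]].
  destruct (bounded_on_unit (f1 s)) as [M [HM Hb]].
  { intros w Hw. apply cont_deriv with (f2 s), HC; trivial. }
  apply (profile_to_wave (f s) P c (M + 1)); trivial; [| lra].
  intros w Hw. split; [left; apply Hpos; trivial|].
  destruct (unit_MVT (f s) (f1 s) w 1) as [z [Hz E]]; try lra; [apply HC|].
  rewrite fone in E. specialize (Hb z ltac:(unfold unit_interval; lra)).
  apply Rabs_le_between in Hb. nra.
Qed.

(** By (A2) with [n = 2], one bound on the second derivative serves a whole neighbourhood of [s].
    This lets [threshold_slope] fix its barrier before the parameter increment. *)
Lemma family_linear_at_0 (f f1 f2 : R -> R -> R) (s : R) :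
  monostable_family f f1 f2 -> lipschitz_in_parameter f f1 f2 -> 0 <= s ->
  exists K, 0 < K /\ forall s', 0 <= s' -> Rabs (s' - s) <= 1 -> linear_at_0 K (f s').
Proof.
  intros HA1 [L0 [HL0 HL]] Hs.
  destruct (bounded_on_unit (f2 s)) as [M [HM Hb]].
  { intros w Hw. apply (HA1 s Hs); trivial. }
  exists (M + L0). split; [lra|]. intros s' Hs' Hd.
  destruct (HA1 s' Hs') as [HC [f0 [fone [f10 [_ Hpos]]]]].
  apply (linear_at_0_intro (f s') (f1 s') (f2 s')); trivial; [lra|].
  intros w Hw. specialize (Hb w Hw). destruct (HL w s' s Hw Hs' Hs) as [_ [_ A]].
  replace (f2 s' w) with (f2 s w + (f2 s' w - f2 s w)) by ring.
  eapply Rle_trans; [apply Rabs_triang|].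
  assert (L0 * Rabs (s' - s) <= L0) by nra. lra.
Qed.

(** Near 1 the bound follows from [f'(1) < 0]; on the remaining compact interval, from the positive
    minimum of [f] and [1 - w <= 1]. *)
Lemma linear_lower_bound_near_1 (f f1 f2 : R -> R -> R) (s w0 : R) :
  monostable_family f f1 f2 -> 0 <= s -> 0 < w0 < 1 ->
  exists m, 0 < m /\ forall w, w0 <= w < 1 -> m * (1 - w) <= f s w.
Proof.
  intros HA1 Hs Hw0. destruct (HA1 s Hs) as [HC [f0 [fone [_ [f11 Hpos]]]]].
  assert (Hc1 : continue_in (f1 s) unit_interval 1).
  { apply cont_deriv with (f2 s), HC. unfold unit_interval. lra. }
  destruct (Hc1 (- f1 s 1 / 2)) as [d [Hd Hnear]]; [lra|].
  simpl in Hnear. unfold Rdist in Hnear.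
  pose (b := Rmax w0 (1 - d / 2)).
  assert (Hb : w0 <= b < 1 /\ 1 - d / 2 <= b).
  { unfold b. split; [split|]; [apply Rmax_l | apply Rmax_lub_lt; lra | apply Rmax_r]. }
  destruct (continuity_ab_min (fun x => f s (clamp x)) w0 b) as [z [Hz Hzr]]; [lra | |].
  { intros x _. apply continuity_pt_filterlim, (continuous_clamp_comp (f s)).
    intros w Hw. apply cont_deriv with (f1 s), HC; trivial. }
  simpl in Hz. rewrite (clamp_id z) in Hz by lra.
  assert (Hzp : 0 < f s z) by (apply Hpos; lra).
  exists (Rmin (f s z) (- f1 s 1 / 2)).
  assert (M1 := Rmin_l (f s z) (- f1 s 1 / 2)). assert (M2 := Rmin_r (f s z) (- f1 s 1 / 2)).
  assert (M0 : 0 < Rmin (f s z) (- f1 s 1 / 2)) by (apply Rmin_glb_lt; lra).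
  set (m := Rmin (f s z) (- f1 s 1 / 2)) in *.
  split; trivial. intros w Hw. destruct (Rle_lt_dec w b) as [H|H].
  - specialize (Hz w ltac:(lra)). rewrite clamp_id in Hz by lra. nra.
  - destruct (unit_MVT (f s) (f1 s) w 1) as [y [Hy E]]; try lra; [apply HC|].
    rewrite fone in E.
    assert (f1 s y <= f1 s 1 / 2).
    { destruct (Req_dec y 1) as [-> | Hne]; [lra|].
      assert (A : Rabs (f1 s y - f1 s 1) < - f1 s 1 / 2).
      { apply Hnear. split.
        - split; [unfold unit_interval; lra | auto].
        - apply Rabs_def1; lra. }
      apply Rabs_def2 in A. lra. }
    nra.
Qed.

Lemma family_gap_near_1 (f f1 f2 : R -> R -> R) (L0 s s' w : R) :
  monostable_family f f1 f2 ->
  (forall w s s', unit_interval w -> 0 <= s -> 0 <= s' ->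
     Rabs (f1 s w - f1 s' w) <= L0 * Rabs (s - s')) ->
  0 <= s -> s <= s' -> 0 < w < 1 -> f s' w - f s w <= L0 * (s' - s) * (1 - w).
Proof.
  intros HA1 HL Hs Hss Hw.
  destruct (HA1 s Hs) as [HC [_ [fone _]]].
  destruct (HA1 s' ltac:(lra)) as [HC' [_ [fone' _]]].
  destruct (unit_MVT (fun w => f s' w - f s w) (fun w => f1 s' w - f1 s w) w 1)
    as [z [Hz E]]; try lra.
  { intros v Hv. apply Dminus; [apply HC' | apply HC]; trivial. }
  rewrite fone, fone' in E.
  assert (A := HL z s' s ltac:(unfold unit_interval; lra) ltac:(lra) Hs).
  rewrite (Rabs_right (s' - s)) in A by lra. apply Rabs_le_between in A. nra.
Qed.

Lemma family_gap_near_0 (f f1 f2 : R -> R -> R) (s s' : R) :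
  monostable_family f f1 f2 -> increasing_in_parameter f f2 -> 0 <= s -> s < s' ->
  exists w0 e, 0 < w0 < 1 /\ 0 < e /\
    forall w, 0 < w <= w0 -> e * w ^ 2 <= f s' w - f s w.
Proof.
  intros HA1 HA3 Hs Hss. destruct (HA3 s s' Hs Hss) as [Hinc Hinc2].
  destruct (HA1 s Hs) as [HC [f0 [_ [f10 _]]]].
  destruct (HA1 s' ltac:(lra)) as [HC' [f0' [_ [f10' _]]]].
  pose (k := f2 s' 0 - f2 s 0).
  assert (Hc : continue_in (fun w => f2 s' w - f2 s w) unit_interval 0).
  { apply limit_minus; [apply HC' | apply HC]; unfold unit_interval; lra. }
  destruct (Hc (k / 2)) as [d [Hd Hnear]]; [unfold k; lra|].
  simpl in Hnear. unfold Rdist in Hnear.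
  assert (Hk : forall z, 0 <= z <= 1 -> z < d -> k / 2 <= f2 s' z - f2 s z).
  { intros z Hz Hzd. destruct (Req_dec z 0) as [-> | Hne]; [unfold k; lra|].
    assert (A : Rabs (f2 s' z - f2 s z - (f2 s' 0 - f2 s 0)) < k / 2).
    { apply Hnear. split.
      - split; [unfold unit_interval; lra | auto].
      - apply Rabs_def1; lra. }
    apply Rabs_def2 in A. unfold k in *. lra. }
  (* On [[w/2, w]] the gap of first derivatives is at least [(k/2) (w/2)]. Over the length [w/2],
     starting from a positive gap at [w/2], this yields [k w^2 / 8]. *)
  exists (Rmin (/ 2) (d / 2)), (k / 8).
  assert (A := Rmin_l (/ 2) (d / 2)). assert (B := Rmin_r (/ 2) (d / 2)).
  assert (C : 0 < Rmin (/ 2) (d / 2)) by (apply Rmin_glb_lt; lra).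
  split; [lra | split; [unfold k; lra|]].
  intros w Hw.
  destruct (unit_MVT (fun w => f s' w - f s w) (fun w => f1 s' w - f1 s w) (w / 2) w)
    as [z [Hz E]]; try lra.
  { intros v Hv. apply Dminus; [apply HC' | apply HC]; trivial. }
  destruct (unit_MVT (fun w => f1 s' w - f1 s w) (fun w => f2 s' w - f2 s w) 0 z)
    as [y [Hy E']]; try lra.
  { intros v Hv. apply Dminus; [apply HC' | apply HC]; trivial. }
  rewrite f10, f10' in E'.
  specialize (Hk y ltac:(lra) ltac:(lra)). specialize (Hinc (w / 2) ltac:(lra)).
  assert (k / 2 * (w / 2) <= f1 s' z - f1 s z).
  { apply Rle_trans with (k / 2 * z); [| nra].
    apply Rmult_le_compat_l; [unfold k; lra | lra]. }
  nra.
Qed.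

(* P_s + eta is a supersolution for f_{s'} away from w = 0, because f_s and
   f_{s'} - f_s vanish at the same linear rate at w = 1. *)
Lemma profile_shift (f f1 f2 : R -> R -> R) (L0 s s' w0 m eta : R) (P P' : R -> R) :
  monostable_family f f1 f2 ->
  (forall w s s', unit_interval w -> 0 <= s -> 0 <= s' ->
     Rabs (f1 s w - f1 s' w) <= L0 * Rabs (s - s')) ->
  0 <= s -> s <= s' -> 0 < w0 < 1 ->
  (forall w, w0 <= w < 1 -> m * (1 - w) <= f s w) ->
  0 < eta -> 2 * (L0 * (s' - s)) <= m * eta -> 0 <= L0 ->
  connecting (f s) 2 P -> profile (f s') 2 P' -> P' w0 <= P w0 + eta.
Proof.
  intros HA1 HL Hs Hss Hw0 Hm Heta HLm HL0 HP HP'.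
  assert (Hpos : forall r w, 0 <= r -> 0 < w < 1 -> 0 <= f r w).
  { intros r w Hr Hw. left. apply (HA1 r Hr); trivial. }
  apply (profile_le_supersolution (f s') P' (fun w => P w + eta) 2); trivial.
  - intros w Hw. apply Hpos; lra.
  - intros b Hb w Hw.
    destruct (proj1 (proj1 HP) w) as [Pp D]; [lra|].
    split; [lra|]. exists (2 - f s w / P w). split.
    + replace (2 - f s w / P w) with (2 - f s w / P w + 0) by ring.
      apply (is_derive_plus P (fun _ => eta)); [trivial | exact (is_derive_const eta w)].
    + assert (f s' w / (P w + eta) <= f s w / P w); [| lra].
      apply Rle_div_l; [lra|].
      replace (f s w / P w * (P w + eta)) with (f s w * (P w + eta) / P w) by (field; lra).
      apply (proj1 (Rle_div_r (f s' w) (f s w * (P w + eta)) (P w) Pp)).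
      assert (P2 : P w <= 2 * w).
      { apply (connecting_le_linear (f s) P 2); trivial; [| lra].
        intros v Hv. apply Hpos; trivial. }
      assert (Hgap := family_gap_near_1 f f1 f2 L0 s s' w HA1 HL Hs Hss ltac:(lra)).
      specialize (Hm w ltac:(lra)).
      (* Since [P <= 2], the left side is at most [2 L0 (s' - s) (1 - w) <= m eta (1 - w)], and
         [m (1 - w) <= f s w]. *)
      assert (A : (f s' w - f s w) * P w <= f s w * eta); [| nra].
      assert (0 <= L0 * (s' - s)) by (apply Rmult_le_pos; lra).
      apply Rle_trans with (L0 * (s' - s) * (1 - w) * 2).
      * apply Rle_trans with (L0 * (s' - s) * (1 - w) * P w).
        -- apply Rmult_le_compat_r; lra.
        -- apply Rmult_le_compat_l; [apply Rmult_le_pos; lra | lra].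
      * apply Rle_trans with (m * (1 - w) * eta); [nra|].
        apply Rmult_le_compat_r; lra.
Qed.

(** * The set of parameters admitting a profile of speed 2, and its endpoint *)

Lemma vanishing_at_0_of_le (P : R -> R) (k w0 : R) :
  0 < k -> 0 < w0 < 1 -> (forall w, 0 < w <= w0 -> P w <= k * w) -> vanishing_at_0 P.
Proof.
  intros Hk Hw0 HP e He.
  destruct (small_multiple k (e / 2)) as [w1 [Hw1 Hs]]; [lra | lra |].
  pose (d := Rmin w0 w1).
  assert (Hd : 0 < d /\ d <= w0 /\ d <= w1).
  { unfold d. split; [apply Rmin_glb_lt; lra | split; [apply Rmin_l | apply Rmin_r]]. }
  exists d. split; [lra|]. intros w Hw. specialize (HP w ltac:(lra)). nra.
Qed.

Lemma connecting_of_supersolution (f f1 f2 : R -> R -> R) (s k : R) (Z : R -> R) :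
  monostable_family f f1 f2 -> 0 <= s -> 0 < k ->
  (forall w, 0 < w < 1 -> Z w <= k * w) ->
  (forall a b, 0 < a -> b < 1 -> supersolution (f s) 2 a b Z) ->
  exists P, connecting (f s) 2 P.
Proof.
  intros HA1 Hs Hk HZk HZ.
  destruct (monostable_profile_exists f f1 f2 s 2 HA1 Hs ltac:(lra)) as [P HP].
  exists P. split; trivial.
  apply (vanishing_at_0_of_le P k (/ 2)); [trivial | lra |].
  intros w Hw. apply Rle_trans with (Z w); [| apply HZk; lra].
  apply (profile_le_supersolution (f s) P Z 2); trivial; [| lra |].
  - intros v Hv. left. apply (HA1 s Hs); trivial.
  - intros b Hb. apply HZ; lra.
Qed.

Lemma connecting_downward (f f1 f2 : R -> R -> R) (s s' : R) (P' : R -> R) :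
  monostable_family f f1 f2 -> increasing_in_parameter f f2 -> 0 <= s -> s < s' ->
  connecting (f s') 2 P' -> exists P, connecting (f s) 2 P.
Proof.
  intros HA1 HA3 Hs Hss HP'.
  apply (connecting_of_supersolution f f1 f2 s 2 P'); trivial; [lra | |].
  - apply (connecting_le_linear (f s') P' 2); trivial.
    intros v Hv. left. apply (HA1 s' ltac:(lra)); trivial.
  - intros a b Ha Hb w Hw. destruct (proj1 (proj1 HP') w) as [Pp D]; [lra|].
    split; trivial. exists (2 - f s' w / P' w). split; trivial.
    assert (f s w / P' w <= f s' w / P' w); [| lra].
    apply Rmult_le_compat_r; [left; apply Rinv_0_lt_compat; trivial|].
    left. apply (HA3 s s' Hs Hss). lra.
Qed.

Lemma connecting_of_KPP (f f1 f2 : R -> R -> R) (s : R) :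
  monostable_family f f1 f2 -> 0 <= s -> KPP_condition (f s) (f1 s) ->
  exists P, connecting (f s) 2 P.
Proof.
  intros HA1 Hs HK.
  apply (connecting_of_supersolution f f1 f2 s 1 (fun w => w)); trivial; [lra | intros; lra |].
  intros a b Ha Hb w Hw. split; [lra|]. exists 1. split; [exact (is_derive_id w)|].
  assert (A := HK w ltac:(unfold unit_interval; lra)).
  destruct (HA1 s Hs) as [_ [_ [_ [f10 _]]]]. rewrite f10 in A.
  assert (f s w / w <= 1); [| lra]. apply Rle_div_l; lra.
Qed.

Lemma connecting_left_closed (f f1 f2 : R -> R -> R) (s : R) :
  monostable_family f f1 f2 -> lipschitz_in_parameter f f1 f2 ->
  increasing_in_parameter f f2 -> 0 < s ->
  (forall r, 0 <= r < s -> exists P, connecting (f r) 2 P) ->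
  exists P, connecting (f s) 2 P.
Proof.
  intros HA1 [L0 [HL0 HL]] HA3 Hs Hr.
  assert (HL1 : forall w s s', unit_interval w -> 0 <= s -> 0 <= s' ->
     Rabs (f1 s w - f1 s' w) <= L0 * Rabs (s - s')) by (intros; apply HL; trivial).
  destruct (monostable_profile_exists f f1 f2 s 2 HA1 ltac:(lra) ltac:(lra)) as [P HP].
  exists P. split; trivial.
  apply (vanishing_at_0_of_le P 2 (/ 2)); [lra | lra |]. intros w Hw.
  apply Rnot_lt_le; intros Hlt.
  pose (eta := (P w - 2 * w) / 2). assert (Heta : 0 < eta) by (unfold eta; lra).
  (* The bound is taken at parameter 0, below all other members of the family: [m] must be fixed
     before the approximating parameter [s - d] is chosen. *)
  destruct (linear_lower_bound_near_1 f f1 f2 0 w HA1 (Rle_refl _) ltac:(lra)) as [m [Hm Hm']].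
  pose (d := Rmin s (m * eta / (2 * L0))).
  assert (Hd0 : 0 < m * eta / (2 * L0)) by (apply Rdiv_lt_0_compat; nra).
  assert (Hd : 0 < d /\ d <= s /\ d <= m * eta / (2 * L0)).
  { unfold d. split; [apply Rmin_glb_lt; lra | split; [apply Rmin_l | apply Rmin_r]]. }
  destruct (Hr (s - d)) as [Q HQ]; [lra|].
  assert (A : P w <= Q w + eta).
  { apply (profile_shift f f1 f2 L0 (s - d) s w m eta Q P); trivial; try lra.
    - intros v Hv. eapply Rle_trans; [apply Hm'; trivial|].
      destruct (Req_dec (s - d) 0) as [-> | Hne]; [lra|].
      left. apply (HA3 0 (s - d)); lra.
    - destruct Hd as [_ [_ Hd]]. apply (Rmult_le_compat_r (2 * L0)) in Hd; [|lra].
      replace (m * eta / (2 * L0) * (2 * L0)) with (m * eta) in Hd by (field; lra). lra. }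
  assert (B : Q w <= 2 * w).
  { apply (connecting_le_linear (f (s - d)) Q 2); trivial; [| lra].
    intros v Hv. left. apply (HA1 (s - d) ltac:(lra)); trivial. }
  unfold eta in A. lra.
Qed.

Lemma threshold_slope (f f1 f2 : R -> R -> R) (s K : R) (P : R -> R) :
  monostable_family f f1 f2 -> lipschitz_in_parameter f f1 f2 -> 0 <= s ->
  0 < K -> (forall s', 0 <= s' -> Rabs (s' - s) <= 1 -> linear_at_0 K (f s')) ->
  connecting (f s) 2 P ->
  (forall s', s < s' -> ~ exists Q, connecting (f s') 2 Q) ->
  exists w0, 0 < w0 < 1 /\
    forall w, 0 < w <= w0 -> 9 / 10 <= slope P w /\ 1 - 8 * K * w <= slope P w.
Proof.
  intros HA1 [L0 [HL0 HL]] Hs HK HlinK HP Hnot.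
  assert (HL1 : forall w s s', unit_interval w -> 0 <= s -> 0 <= s' ->
     Rabs (f1 s w - f1 s' w) <= L0 * Rabs (s - s')) by (intros; apply HL; trivial).
  assert (Hlin : linear_at_0 K (f s)).
  { apply HlinK; trivial. rewrite Rminus_diag, Rabs_R0. lra. }
  destruct (slope_dichotomy (f s) P K Hlin HP) as [w1 [Hw1 [H|[C HC]]]];
    [exists w1; split; trivial|].
  exfalso.
  destruct (logarithmic_supersolution K HK) as [w2 [Hw2 Hsuper]].
  (* Once [- ln w > 2 |C|], one has [C - 3/2 ln w < - 2 ln w], so the slow branch lies strictly
     below the barrier [Z]. *)
  destruct (ln_unbounded_below (- 2 * Rabs C)) as [w3 [Hw3 Hln]].
  pose (w := Rmin w1 (Rmin w2 w3)).
  assert (Hw : 0 < w /\ w <= w1 /\ w <= w2 /\ w <= w3).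
  { unfold w. repeat split.
    - repeat apply Rmin_glb_lt; lra.
    - apply Rmin_l.
    - eapply Rle_trans; [apply Rmin_r | apply Rmin_l].
    - eapply Rle_trans; [apply Rmin_r | apply Rmin_r]. }
  specialize (Hln w ltac:(lra)).
  assert (HC1 := Rle_abs C). assert (HC2 := Rabs_pos C).
  pose (Z := fun w => w + w / (2 * ln w)).
  assert (HPZ : P w < Z w).
  { destruct (HC w) as [Cp Cq]; [lra|].
    assert (A : / (- 2 * ln w) < / (C - 3 / 2 * ln w)).
    { apply Rinv_lt_contravar; [apply Rmult_lt_0_compat; lra | lra]. }
    assert (B : slope P w < 1 - / (- 2 * ln w)) by lra.
    apply (Rmult_lt_compat_r w) in B; [|lra].
    unfold slope in B. replace (P w / w * w) with (P w) in B by (field; lra).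
    unfold Z. replace (w + w / (2 * ln w)) with ((1 - / (- 2 * ln w)) * w) by (field; lra).
    trivial. }
  destruct (linear_lower_bound_near_1 f f1 f2 s w HA1 Hs ltac:(lra)) as [m [Hm Hm']].
  pose (eta := Z w - P w). assert (Heta : 0 < eta) by (unfold eta; lra).
  pose (d := Rmin 1 (m * eta / (2 * L0))).
  assert (Hd0 : 0 < m * eta / (2 * L0)) by (apply Rdiv_lt_0_compat; nra).
  assert (Hd : 0 < d /\ d <= 1 /\ d <= m * eta / (2 * L0)).
  { unfold d. split; [apply Rmin_glb_lt; lra | split; [apply Rmin_l | apply Rmin_r]]. }
  apply (Hnot (s + d)); [lra|].
  destruct (monostable_profile_exists f f1 f2 (s + d) 2 HA1 ltac:(lra) ltac:(lra)) as [Q HQ].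
  exists Q. split; trivial.
  assert (A : Q w <= Z w).
  { replace (Z w) with (P w + eta) by (unfold eta; ring).
    apply (profile_shift f f1 f2 L0 s (s + d) w m eta P Q); trivial; try lra.
    destruct Hd as [_ [_ Hd]]. apply (Rmult_le_compat_r (2 * L0)) in Hd; [|lra].
    replace (m * eta / (2 * L0) * (2 * L0)) with (m * eta) in Hd by (field; lra). lra. }
  apply (vanishing_at_0_of_le Q 1 w); [lra | lra |]. intros v Hv.
  assert (HlnV : ln v < 0) by (rewrite <- ln_1; apply ln_increasing; lra).
  apply Rle_trans with (Z v).
  (* The gluing: to the left of [w] the barrier is [Z], and an excess of [Q] over it would persist
     up to [w], where [Q <= Z] is already known. *)
  - apply Rnot_lt_le; intros Hlt.
    assert (B := excess_over_supersolution (f (s + d)) Q Z 2 v w).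
    assert (Q v - Z v <= Q w - Z w); [| lra].
    apply B; trivial; try lra.
    + intros x Hx. left. apply (HA1 (s + d) ltac:(lra)); trivial.
    + apply Hsuper; try lra. apply HlinK; [lra|]. apply Rabs_le_between. lra.
  - unfold Z. assert (v / (2 * ln v) < 0); [| lra].
    apply Rmult_pos_neg; [lra | apply Rinv_lt_0_compat; lra].
Qed.

Theorem theorem1p5
  (f f1 f2 : R -> R -> R) (cstar : R -> R) (s1 s2 : R)
  (HA1 : monostable_family f f1 f2)
  (HA2 : lipschitz_in_parameter f f1 f2)
  (HA3 : increasing_in_parameter f f2)
  (Hcstar : forall s, 0 <= s -> minimal_speed (f s) (cstar s))
  (Hs1 : 0 < s1)
  (HA4 : KPP_condition (f s1) (f1 s1))
  (Hs2 : s1 < s2)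
  (HA5 : 2 < cstar s2) :
  exists sstar : R,
    s1 <= sstar < s2 /\
    (forall s, 0 <= s <= sstar -> cstar s = 2) /\
    (forall s, sstar < s -> 2 < cstar s) /\
    (forall s, 0 <= s ->
       forall W : R -> R, travelling_wave (f s) (cstar s) W ->
         (pure_exponential_decay W <-> s = sstar)).
Proof.
  (* For [s >= 0] this is equivalent to [cstar s = 2], but it can be compared between parameters. *)
  pose (pulled := fun s => exists P, connecting (f s) 2 P).
  assert (Hlin : forall s, 0 <= s -> exists K, linear_at_0 K (f s)).
  { intros s Hs. destruct (family_linear_at_0 f f1 f2 s HA1 HA2 Hs) as [K [_ HK]].
    exists K. apply HK; trivial. rewrite Rminus_diag, Rabs_R0. lra. }
  assert (Hpos : forall s w, 0 <= s -> 0 < w < 1 -> 0 <= f s w).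
  { intros s w Hs Hw. left. apply (HA1 s Hs); trivial. }
  assert (Hge : forall s, 0 <= s -> 2 <= cstar s).
  { intros s Hs. destruct (proj2 (Hcstar s Hs (cstar s)) (Rle_refl _)) as [W HW].
    destruct (wave_to_profile (f s) W (cstar s) (fun w => Hpos s w Hs) HW) as [P [X [HP _]]].
    destruct (Hlin s Hs) as [K HK]. apply (connecting_speed_ge_2 (f s) P _ K HK HP). }
  assert (Hpulled : forall s, 0 <= s -> pulled s -> cstar s = 2).
  { intros s Hs [P HP]. apply Rle_antisym; [| apply Hge; trivial].
    apply (Hcstar s Hs). apply (connecting_to_wave f f1 f2 s 2 P); trivial. lra. }
  assert (Hpulled' : forall s, 0 <= s -> cstar s = 2 -> pulled s).
  { intros s Hs E. destruct (proj2 (Hcstar s Hs 2) ltac:(lra)) as [W HW].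
    destruct (wave_to_profile (f s) W 2 (fun w => Hpos s w Hs) HW) as [P [X [HP _]]].
    exists P. trivial. }
  assert (Hdown : forall s s', 0 <= s -> s < s' -> pulled s' -> pulled s).
  { intros s s' Hs Hss [P HP]. apply (connecting_downward f f1 f2 s s' P); trivial. }
  assert (Hs1p : pulled s1) by (apply (connecting_of_KPP f f1 f2); trivial; lra).
  assert (Hs2p : ~ pulled s2).
  { intros H. assert (E := Hpulled s2 ltac:(lra) H). lra. }
  destruct (completeness (fun s => 0 <= s /\ pulled s)) as [sstar [Hub Hlub]].
  { exists s2. intros s [Hs Hp]. apply Rnot_lt_le; intros H. apply Hs2p.
    apply (Hdown s2 s); trivial. lra. }
  { exists s1. split; [lra | trivial]. }
  assert (H1 : s1 <= sstar) by (apply Hub; split; [lra | trivial]).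
  assert (Hbelow : forall s, 0 <= s < sstar -> pulled s).
  { intros s Hs. apply NNPP; intros Hn.
    assert (sstar <= s); [| lra].
    apply Hlub. intros r [Hr Hp]. apply Rnot_lt_le; intros H. apply Hn.
    apply (Hdown s r); trivial; lra. }
  assert (Hstar : pulled sstar).
  { apply (connecting_left_closed f f1 f2); trivial. lra. }
  assert (Habove : forall s, sstar < s -> ~ pulled s).
  { intros s Hs Hp. assert (s <= sstar); [| lra]. apply Hub. split; [lra | trivial]. }
  assert (H2 : sstar < s2).
  { apply Rnot_le_lt; intros [H|H].
    - apply Hs2p, Hbelow. lra.
    - apply Hs2p. rewrite H. trivial. }
  exists sstar. split; [split; trivial|]. split; [| split].
  - intros s Hs. apply Hpulled; [lra|].
    destruct (proj2 Hs) as [H| ->]; [apply Hbelow; lra | trivial].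
  - intros s Hs. destruct (Hge s ltac:(lra)) as [H|H]; trivial.
    exfalso. apply (Habove s Hs). apply Hpulled'; [lra | symmetry; trivial].
  - intros s Hs W HW.
    destruct (wave_to_profile (f s) W (cstar s) (fun w => Hpos s w Hs) HW)
      as [P [X [HP HX]]].
    split.
    + intros Hpure. destruct (Rtotal_order s sstar) as [H|[H|H]]; trivial; exfalso.
      (* The larger parameter that rules out pure decay at [s] is [sstar] itself, which has a
         profile of speed 2 by [Hstar]. *)
      * rewrite (Hpulled s Hs (Hbelow s ltac:(lra))) in HP.
        destruct (Hlin s Hs) as [K HK]. destruct (Hlin sstar ltac:(lra)) as [K' HK'].
        destruct Hstar as [P' HP'].
        apply (linear_at_0_weaken _ _ _ (Rmax_l K K')) in HK.
        apply (linear_at_0_weaken _ _ _ (Rmax_r K K')) in HK'.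
        destruct (slope_lower_of_pure (f s) W P X (Rmax K K') HK HP HX Hpure)
          as [w1 [Hw1 Hlow]].
        destruct (family_gap_near_0 f f1 f2 s sstar HA1 HA3 Hs H)
          as [w2 [e [Hw2 [He Hgap]]]].
        pose (w0 := Rmin w1 w2).
        assert (Hw0 : 0 < w0 /\ w0 <= w1 /\ w0 <= w2).
        { unfold w0. split; [apply Rmin_glb_lt; lra | split; [apply Rmin_l | apply Rmin_r]]. }
        apply (no_profile_above_pure (f s) (f sstar) P P' (Rmax K K') w0 e); trivial.
        -- intros w Hw. left. apply (HA3 s sstar Hs H); trivial.
        -- lra.
        -- intros w Hw. apply Hgap. lra.
        -- intros w Hw. apply Hlow. lra.
      * destruct (Hlin s Hs) as [K HK].
        apply (pushed_wave_not_pure (f s) W P X (cstar s) K); trivial.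
        destruct (Hge s Hs) as [H'|H']; trivial.
        exfalso. apply (Habove s H), Hpulled'; [trivial | symmetry; trivial].
    + intros ->. rewrite (Hpulled sstar Hs Hstar) in HP.
      destruct (family_linear_at_0 f f1 f2 sstar HA1 HA2 Hs) as [K [HK0 HK]].
      destruct (threshold_slope f f1 f2 sstar K P HA1 HA2 Hs HK0 HK HP) as [w0 [Hw0 Hlow]].
      { intros s' Hs'. apply Habove; trivial. }
      apply (pure_of_slope_bounds (f sstar) W P X K w0); trivial.
      apply HK; trivial. rewrite Rminus_diag, Rabs_R0. lra.
Qed.
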